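(* Let $R>1$, $0<\epsilon<1$ and $C_0\in\mathbb{R}$, and let $v$ be a (smooth) solution of the boundary value problem $$\begin{cases}\Delta v+2C_0^2e^v=0 & \text{in } A(1-\epsilon,R+\epsilon),\\ \frac{\partial v}{\partial n}=2e^{-\frac12 v}-2 & \text{on } |z|=1,\\ \frac{\partial v}{\partial n}=\frac{2}{R^2}e^{-\frac12 v}+\frac{2}{R} & \text{on } |z|=R,\end{cases}$$ where $A(a,b)=\{z\in\mathbb{C}: a<|z|<b\}$, $\Delta=4\frac{\partial}{\partial z}\frac{\partial}{\partial\bar z}$, and $n$ is the inner unit normal to $A(1,R)$. For $0\le\delta<1$ let $H_{R,\delta}=\{\xi\in\mathbb{C}:\log(1-\delta)<\operatorname{Im}\xi<\log(R+\delta)\}$ and $H^0_{R,\delta}=H_{R,\delta}\cap\{\xi: 0\le\operatorname{Re}\xi\le 2\pi\}$. Then there exist a minimal immersion $X:H_{R,\epsilon}\to\mathbb{R}^3$ and unit spheres $S_{O_1}$, $S_{O_2}$ (centered at $O_1$ and $O_2$ respectively) such that: (1) if $\Lambda$ denotes the conformal factor of $X$, i.e. the induced metric is $\Lambda^2|d\xi|^2$, then $v(e^{-i\xi})=\log\frac{1}{\Lambda^2(\xi)|e^{-i\xi}|^2}$ for all $\xi\in H_{R,\epsilon}$; (2) $S_{O_1}$ and $S_{O_2}$ intersect $X(H_{R,\epsilon})$ orthogonally along the level curves $\operatorname{Im}\xi=0$ and $\operatorname{Im}\xi=\log R$, respectively; (3) there is a rigid motion $T$ of $\mathbb{R}^3$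 with $T\cdot X(H^0_{R,\epsilon})=X(H^0_{R,\epsilon}+2\pi)$ and $X(H_{R,\epsilon})=\bigcup_{n\in\mathbb{Z}}T^n\cdot X(H^0_{R,\epsilon})$.
   Context: $H_{R,\epsilon}$ is the universal cover of $A(1-\epsilon,R+\epsilon)$ via the covering map $z=e^{-i\xi}$. The set $X(H^0_{R,0})$ is called a fundamental piece. *)

(* Defs.v *)
From Stdlib Require Import Reals ZArith.
From Coquelicot Require Import Coquelicot.
Open Scope R_scope.

(** * Calculus in two real variables (the plane C = R^2, z = x + i y) *)

Definition dx (f : R -> R -> R) : R -> R -> R :=
  fun x y => Derive (fun t => f t y) x.
Definition dy (f : R -> R -> R) : R -> R -> R :=
  fun x y => Derive (fun t => f x t) y.

Fixpoint Ck (k : nat) (U : R -> R -> Prop) (f : R -> R -> R) : Prop :=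
  match k with
  | O => forall x y, U x y ->
           continuous (fun p : R * R => f (fst p) (snd p)) (x, y)
  | S k' =>
      (forall x y, U x y ->
         ex_derive (fun t => f t y) x /\ ex_derive (fun t => f x t) y)
      /\ Ck k' U f /\ Ck k' U (dx f) /\ Ck k' U (dy f)
  end.

Definition smooth_on (U : R -> R -> Prop) (f : R -> R -> R) : Prop :=
  forall k, Ck k U f.

(** Laplacian  Delta = 4 d/dz d/dzbar = d_xx + d_yy *)
Definition laplacian (f : R -> R -> R) : R -> R -> R :=
  fun x y => dx (dx f) x y + dy (dy f) x y.

Definition annulus (a b : R) (x y : R) : Prop :=
  a < sqrt (x ^ 2 + y ^ 2) < b.

Record vec3 := V3 { c1 : R; c2 : R; c3 : R }.

Definition vadd (u w : vec3) : vec3 := V3 (c1 u + c1 w) (c2 u + c2 w) (c3 u + c3 w).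
Definition vsub (u w : vec3) : vec3 := V3 (c1 u - c1 w) (c2 u - c2 w) (c3 u - c3 w).
Definition vscale (a : R) (u : vec3) : vec3 := V3 (a * c1 u) (a * c2 u) (a * c3 u).
Definition dot (u w : vec3) : R := c1 u * c1 w + c2 u * c2 w + c3 u * c3 w.
Definition cross (u w : vec3) : vec3 :=
  V3 (c2 u * c3 w - c3 u * c2 w)
     (c3 u * c1 w - c1 u * c3 w)
     (c1 u * c2 w - c2 u * c1 w).
Definition vnorm (u : vec3) : R := sqrt (dot u u).

(** * Surfaces X : (s,t) |-> X(s + i t) in R^3 *)
Definition vdx (X : R -> R -> vec3) : R -> R -> vec3 :=
  fun s t => V3 (dx (fun a b => c1 (X a b)) s t)
                (dx (fun a b => c2 (X a b)) s t)
                (dx (fun a b => c3 (X a b)) s t).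
Definition vdy (X : R -> R -> vec3) : R -> R -> vec3 :=
  fun s t => V3 (dy (fun a b => c1 (X a b)) s t)
                (dy (fun a b => c2 (X a b)) s t)
                (dy (fun a b => c3 (X a b)) s t).

Definition unit_normal (X : R -> R -> vec3) (s t : R) : vec3 :=
  vscale (/ vnorm (cross (vdx X s t) (vdy X s t))) (cross (vdx X s t) (vdy X s t)).

Definition mean_curvature (X : R -> R -> vec3) (s t : R) : R :=
  let Xs := vdx X s t in
  let Xt := vdy X s t in
  let E := dot Xs Xs in
  let F := dot Xs Xt in
  let G := dot Xt Xt in
  let N := unit_normal X s t in
  let e := dot N (vdx (vdx X) s t) in
  let f := dot N (vdy (vdx X) s t) in
  let g := dot N (vdy (vdy X) s t) in
  (e * G - 2 * f * F + g * E) / (2 * (E * G - F ^ 2)).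

Definition smooth_immersion (U : R -> R -> Prop) (X : R -> R -> vec3) : Prop :=
  smooth_on U (fun s t => c1 (X s t)) /\
  smooth_on U (fun s t => c2 (X s t)) /\
  smooth_on U (fun s t => c3 (X s t)) /\
  (forall s t, U s t -> cross (vdx X s t) (vdy X s t) <> V3 0 0 0).

Definition minimal_immersion (U : R -> R -> Prop) (X : R -> R -> vec3) : Prop :=
  smooth_immersion U X /\ (forall s t, U s t -> mean_curvature X s t = 0).

Definition conformal_factor (U : R -> R -> Prop) (X : R -> R -> vec3)
  (Lam : R -> R -> R) : Prop :=
  forall s t, U s t ->
    0 < Lam s t /\
    dot (vdx X s t) (vdx X s t) = Lam s t ^ 2 /\
    dot (vdy X s t) (vdy X s t) = Lam s t ^ 2 /\
    dot (vdx X s t) (vdy X s t) = 0.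

(** The surface meets the unit sphere centered at O orthogonally along the
    level curve Im xi = t0: the curve lies on the sphere, and the sphere's
    normal (X - O) is tangent to the surface there. *)
Definition meets_unit_sphere_orthogonally_along (X : R -> R -> vec3)
  (O : vec3) (t0 : R) : Prop :=
  forall s,
    vnorm (vsub (X s t0) O) = 1 /\
    dot (vsub (X s t0) O) (cross (vdx X s t0) (vdy X s t0)) = 0.

(** rigid motion of R^3: x |-> Q x + b, Q orthogonal with det Q = 1
    (columns q1 q2 q3 orthonormal and right-handed) *)
Definition rigid_motion (T : vec3 -> vec3) : Prop :=
  exists q1 q2 q3 b : vec3,
    dot q1 q1 = 1 /\ dot q2 q2 = 1 /\ dot q3 q3 = 1 /\
    dot q1 q2 = 0 /\ dot q1 q3 = 0 /\ dot q2 q3 = 0 /\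
    cross q1 q2 = q3 /\
    forall x, T x = vadd (vadd (vadd (vscale (c1 x) q1) (vscale (c2 x) q2))
                               (vscale (c3 x) q3)) b.

Definition Zpow_map (T Tinv : vec3 -> vec3) (n : Z) : vec3 -> vec3 :=
  match n with
  | Z0 => fun x => x
  | Zpos p => Nat.iter (Pos.to_nat p) T
  | Zneg p => Nat.iter (Pos.to_nat p) Tinv
  end.

(** strip H_{R,delta} = { xi : log(1-delta) < Im xi < log(R+delta) },
    with xi = s + i t *)
Definition strip_H (Rr delta : R) (s t : R) : Prop :=
  ln (1 - delta) < t < ln (Rr + delta).

Definition strip_H0 (Rr delta : R) (s t : R) : Prop :=
  strip_H Rr delta s t /\ 0 <= s <= 2 * PI.

(* Main.v *)
(** In the coordinate xi = s + i t put w = - v/2 - t. Liouville's equation for v becomes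
    w_ss + w_tt = C0^2 e^(-2w), which is the Gauss equation of a minimal surface with
    conformal factor e^w and Hopf differential C0/2: the Codazzi equations hold trivially.
    The frame equations, with the position added as a fourth unknown, are then a compatible
    linear system on a strip; it is solved along t = 0 and then along each vertical line.
    The boundary conditions read w_t = - e^w on t = 0 and w_t = e^w on t = log R, and say that
    X + X_t/|X_t|, respectively X - X_t/|X_t|, is constant along the boundary curve: these are
    the centers of the spheres. As w is 2 pi-periodic in s, the translate of a solution of
    the frame system is again a solution, hence differs from it by a rigid motion. *)

From Stdlib Require Import Reals ZArith Lra Lia.
From Coquelicot Require Import Coquelicot.
(* Imported last: Stdlib's [C1_fun] has a projection [c1] that would hide the coordinate. *)
Require Import Defs.
Open Scope R_scope.

(** The frame system is linear, so its solutions reach the whole strip without a continuation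
    argument, and the three coordinates of R^3 decouple: each solves the same 4 by 4 system with its
    own initial value. The obstacle is the [s]-equation away from [t = 0]. Integrating along
    vertical lines gives the [t]-equation everywhere, but says nothing about how the solution
    depends on the parameter [s]. Differentiability in [s] is obtained together with its value, from
    a Gronwall estimate whose constant is uniform over all coefficient matrices below a given bound,
    so that it also serves the matrix shifted by [h]. A real constant Hopf differential makes the
    second fundamental form diagonal. Along a horizontal line the [s]-derivative of X_t/|X_t| is
    then w_t X_s/|X_s|, with no normal component, while X_s = e^w X_s/|X_s|. This is why one scalar
    condition on w_t is enough to make the candidate center of the sphere stationary. *)

(** * Inequalities obtained from the sign of a derivative *)

Lemma nondecreasing_of_derive (f f' : R -> R) (a b : R) :
  a <= b ->
  (forall x, a <= x <= b -> is_derive f x (f' x)) ->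
  (forall x, a <= x <= b -> 0 <= f' x) -> f a <= f b.
Proof.
  intros Hab Hd Hp.
  destruct (MVT_gen f a b f') as (c & Hc & E);
    rewrite ?Rmin_left, ?Rmax_right in * by lra.
  - intros x Hx; apply Hd; lra.
  - intros x Hx. apply continuity_pt_filterlim.
    apply (ex_derive_continuous f). exists (f' x). apply Hd; lra.
  - assert (0 <= f' c) by (apply Hp; lra). nra.
Qed.

Lemma exp_monotone (x y : R) : x <= y -> exp x <= exp y.
Proof.
  intros [H | ->]; [left; now apply exp_increasing | right; reflexivity].
Qed.

(** Both [g + d] and [g - d] are nondecreasing. The absolute value around [g t] lets [t] lie on
    either side of [t0]. *)
Lemma abs_le_of_derive (d d' g g' : R -> R) (t0 t : R) :
  (forall x, Rmin t0 t <= x <= Rmax t0 t ->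
     is_derive d x (d' x) /\ is_derive g x (g' x) /\ Rabs (d' x) <= g' x) ->
  d t0 = 0 -> g t0 = 0 -> Rabs (d t) <= Rabs (g t).
Proof.
  intros H Hd Hg.
  assert (Hm : forall e a b, Rmin t0 t <= a -> b <= Rmax t0 t -> a <= b ->
            Rabs e = 1 -> g a + e * d a <= g b + e * d b).
  { intros e a b Ha Hb Hab He.
    apply (nondecreasing_of_derive (fun x => g x + e * d x)
             (fun x => g' x + e * d' x)); [exact Hab | |];
      intros x Hx; destruct (H x ltac:(lra)) as (H1 & H2 & H3).
    - apply (is_derive_plus (V := R_NormedModule)); [exact H2 |].
      apply (is_derive_scal (fun x => d x)); exact H1.
    - assert (Rabs (e * d' x) <= g' x) by (rewrite Rabs_mult, He; lra).
      pose proof (Rle_abs (- (e * d' x))). rewrite Rabs_Ropp in H4. lra. }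
  assert (E1 : Rabs 1 = 1) by (apply Rabs_R1).
  assert (E2 : Rabs (-1) = 1) by (rewrite Rabs_left; lra).
  pose proof (Rle_abs (g t)). pose proof (Rle_abs (- g t)) as H'.
  rewrite Rabs_Ropp in H'.
  destruct (Rle_dec t0 t) as [Ht | Ht].
  - rewrite Rmin_left, Rmax_right in Hm by lra.
    pose proof (Hm 1 t0 t ltac:(lra) ltac:(lra) Ht E1).
    pose proof (Hm (-1) t0 t ltac:(lra) ltac:(lra) Ht E2).
    apply Rabs_le; lra.
  - rewrite Rmin_right, Rmax_left in Hm by lra.
    pose proof (Hm 1 t t0 ltac:(lra) ltac:(lra) ltac:(lra) E1).
    pose proof (Hm (-1) t t0 ltac:(lra) ltac:(lra) ltac:(lra) E2).
    apply Rabs_le; lra.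
Qed.

Lemma finite_uniform_bound (P : nat -> R -> Prop) (N : nat) :
  (forall i K K', K <= K' -> P i K -> P i K') ->
  (forall i, (i <= N)%nat -> exists K, P i K) ->
  exists K, 0 < K /\ forall i, (i <= N)%nat -> P i K.
Proof.
  intros Hmon. induction N as [|N IH]; intros H.
  - destruct (H 0%nat) as [K HK]; [lia |]. exists (Rmax K 1). split.
    + pose proof (Rmax_r K 1). lra.
    + intros i Hi. replace i with 0%nat by lia.
      apply (Hmon _ K); [apply Rmax_l | exact HK].
  - destruct IH as (K1 & HK1 & H1); [intros; apply H; lia |].
    destruct (H (S N)) as [K2 HK2]; [lia |].
    exists (Rmax K1 K2). split; [pose proof (Rmax_l K1 K2); lra |].
    intros i Hi. destruct (Nat.eq_dec i (S N)) as [-> | Hn].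
    + apply (Hmon _ K2); [apply Rmax_r | exact HK2].
    + apply (Hmon _ K1); [apply Rmax_l | apply H1; lia].
Qed.

(** * Linear ordinary differential equations *)

(** Vectors and matrices are indexed by [0, ..., N]. *)
Definition mulmv (N : nat) (a : nat -> nat -> R) (y : nat -> R) (i : nat) : R :=
  sum_f_R0 (fun j => a i j * y j) N.

Lemma mulmv_bound (N : nat) (a : nat -> nat -> R) (y : nat -> R) (i : nat) (K M : R) :
  (forall j, (j <= N)%nat -> Rabs (a i j) <= K) ->
  (forall j, (j <= N)%nat -> Rabs (y j) <= M) ->
  Rabs (mulmv N a y i) <= INR (S N) * K * M.
Proof.
  intros Ha Hy. unfold mulmv.
  eapply Rle_trans; [apply Rsum_abs |].
  rewrite Rmult_assoc, (Rmult_comm (INR (S N))), <- sum_cte.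
  apply sum_Rle. intros j Hj. rewrite Rabs_mult.
  apply Rmult_le_compat; auto using Rabs_pos.
Qed.

Lemma mulmv_minus (N : nat) (a : nat -> nat -> R) (y z : nat -> R) (i : nat) :
  mulmv N a (fun j => y j - z j) i = mulmv N a y i - mulmv N a z i.
Proof.
  unfold mulmv. rewrite <- minus_sum. apply sum_eq. intros; ring.
Qed.

Lemma continuous_sum_f_R0 {T : UniformSpace} (f : nat -> T -> R) (N : nat) (x : T) :
  (forall j, (j <= N)%nat -> continuous (f j) x) ->
  continuous (fun x => sum_f_R0 (fun j => f j x) N) x.
Proof.
  induction N as [|N IH]; intros H; simpl; [apply H; lia |].
  apply (continuous_plus (V := R_NormedModule)); [apply IH; intros |]; apply H; lia.
Qed.

Lemma is_derive_sum_f_R0 (f : nat -> R -> R) (d : nat -> R) (N : nat) (x : R) :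
  (forall j, (j <= N)%nat -> is_derive (f j) x (d j)) ->
  is_derive (fun x => sum_f_R0 (fun j => f j x) N) x (sum_f_R0 d N).
Proof.
  induction N as [|N IH]; intros H; simpl; [apply H; lia |].
  apply (is_derive_plus (V := R_NormedModule)); [apply IH; intros |]; apply H; lia.
Qed.

Lemma continuous_mulmv {T : UniformSpace} (N : nat) (a : nat -> nat -> T -> R)
  (y : nat -> T -> R) (i : nat) (x : T) :
  (forall j, (j <= N)%nat -> continuous (a i j) x) ->
  (forall j, (j <= N)%nat -> continuous (y j) x) ->
  continuous (fun x => mulmv N (fun i j => a i j x) (fun j => y j x) i) x.
Proof.
  intros Ha Hy. apply continuous_sum_f_R0. intros j Hj.
  apply (continuous_mult (K := R_AbsRing)); auto.
Qed.

Definition convex (D : R -> Prop) : Prop :=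
  forall x y z, D x -> D y -> x <= z <= y -> D z.

Lemma convex_minmax (D : R -> Prop) (x y z : R) :
  convex D -> D x -> D y -> Rmin x y <= z <= Rmax x y -> D z.
Proof.
  intros Hc Hx Hy. unfold Rmin, Rmax.
  destruct (Rle_dec x y); intros Hz; [apply (Hc x y) | apply (Hc y x)]; auto.
Qed.

(** Compactness of [[a, b]] gives bounds on continuous coefficients, and strictness leaves room for
    derivatives at both points. *)
Lemma open_convex_compact (D : R -> Prop) (x y : R) :
  open D -> convex D -> D x -> D y ->
  exists a b, (a < x < b) /\ (a < y < b) /\ forall z, a <= z <= b -> D z.
Proof.
  intros Ho Hc Hx Hy.
  assert (Hwlog : forall x y, x <= y -> D x -> D y ->
    exists a b, (a < x < b) /\ (a < y < b) /\ forall z, a <= z <= b -> D z).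
  { clear x y Hx Hy. intros x y Hxy Hx Hy.
    destruct (Ho x Hx) as [d1 H1]. destruct (Ho y Hy) as [d2 H2].
    pose proof (cond_pos d1). pose proof (cond_pos d2).
    exists (x - d1 / 2), (y + d2 / 2). repeat split; try lra.
    intros z Hz. apply (Hc (x - d1 / 2) (y + d2 / 2)); [| | exact Hz].
    - apply H1. change (Rabs (x - d1 / 2 - x) < d1).
      apply Rabs_lt_between'. lra.
    - apply H2. change (Rabs (y + d2 / 2 - y) < d2).
      apply Rabs_lt_between'. lra. }
  destruct (Rle_dec x y); [apply Hwlog; auto |].
  destruct (Hwlog y x) as (a & b & H1 & H2 & H3); auto; [lra |].
  exists a, b; auto.
Qed.

Lemma is_derive_RInt_convex (D : R -> Prop) (f : R -> R) (t0 t : R) :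
  open D -> convex D -> (forall x, D x -> continuous f x) -> D t0 -> D t ->
  is_derive (fun x => RInt f t0 x) t (f t).
Proof.
  intros Ho Hc Hf H0 Ht.
  apply (is_derive_RInt (V := R_NormedModule) f (fun x => RInt f t0 x) t0); [| auto].
  apply (filter_imp D); [| apply Ho, Ht].
  intros x Hx. apply (RInt_correct (V := R_CompleteNormedModule)), ex_RInt_continuous.
  intros z Hz. apply Hf. apply (convex_minmax D t0 x); auto.
Qed.

Lemma is_derive_const_plus (f : R -> R) (c x l : R) :
  is_derive f x l -> is_derive (fun x => c + f x) x l.
Proof.
  intros H. rewrite <- (Rplus_0_l l).
  apply (is_derive_plus (V := R_NormedModule) (fun _ => c) f x 0 l); [| exact H].
  apply (is_derive_const (V := R_NormedModule) c).
Qed.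

Section LinearODE.

Variables (N : nat) (a : nat -> nat -> R -> R) (c : nat -> R) (t0 : R).

Fixpoint picard (n : nat) (i : nat) (t : R) : R :=
  match n with
  | O => c i
  | S m => c i + RInt (fun x => mulmv N (fun i j => a i j x)
                                      (fun j => picard m j x) i) t0 t
  end.

(** A total function, introduced before the domain [D]: the interval of validity enters only in the
    claims about it. *)
Definition lin_sol (i : nat) (t : R) : R := Lim_seq (fun n => picard n i t).

Variable (D : R -> Prop).
Hypotheses (HDo : open D) (HDc : convex D) (HD0 : D t0)
  (Ha : forall i j t, (i <= N)%nat -> (j <= N)%nat -> D t -> continuous (a i j) t).

Lemma is_derive_picard (n i : nat) (t : R) : (i <= N)%nat -> D t ->
  is_derive (picard (S n) i) t
    (mulmv N (fun i j => a i j t) (fun j => picard n j t) i).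
Proof.
  assert (Hgen : forall m, (forall j x, (j <= N)%nat -> D x -> continuous (picard m j) x) ->
    forall i t, (i <= N)%nat -> D t -> is_derive (picard (S m) i) t
      (mulmv N (fun i j => a i j t) (fun j => picard m j t) i)).
  { clear i t n. intros m Hm i t Hi Ht.
    apply (is_derive_const_plus (fun x => RInt _ t0 x)).
    apply (is_derive_RInt_convex D (fun t => mulmv N (fun i j => a i j t)
             (fun j => picard m j t) i)); auto.
    intros x Hx. apply continuous_mulmv; intros; auto. }
  revert i t. induction n as [|n IH]; intros i t Hi Ht; apply Hgen; auto.
  - intros; apply continuous_const.
  - intros j x Hj Hx. apply (ex_derive_continuous (picard (S n) j)).
    eexists. apply IH; auto.
Qed.

Lemma continuous_picard (n i : nat) (t : R) : (i <= N)%nat -> D t ->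
  continuous (picard n i) t.
Proof.
  intros Hi Ht. destruct n as [|n]; [apply continuous_const |].
  apply (ex_derive_continuous (picard (S n) i)). eexists. apply is_derive_picard; auto.
Qed.

Lemma picard_init (n i : nat) : picard n i t0 = c i.
Proof.
  destruct n; simpl; [easy |]. rewrite RInt_point. apply Rplus_0_r.
Qed.

Lemma coef_bound (alpha beta : R) :
  (forall t, alpha <= t <= beta -> D t) ->
  exists K, 0 < K /\ forall i j t, (i <= N)%nat -> (j <= N)%nat ->
    alpha <= t <= beta -> Rabs (a i j t) <= K.
Proof.
  intros HD.
  destruct (finite_uniform_bound (fun i K => forall j t, (j <= N)%nat ->
    alpha <= t <= beta -> Rabs (a i j t) <= K) N) as (K & HK & H).
  - intros i K K' HKK H j t Hj Ht. apply Rle_trans with K; auto.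
  - intros i Hi.
    destruct (finite_uniform_bound (fun j K => forall t,
      alpha <= t <= beta -> Rabs (a i j t) <= K) N) as (K & HK & H).
    + intros j K K' HKK H t Ht. apply Rle_trans with K; auto.
    + intros j Hj.
      destruct (bounded_continuity (a i j) alpha beta) as [M HM].
      * intros x Hx. apply Ha; auto.
      * exists M. intros t Ht. left. apply (HM t Ht).
    + exists K. intros; apply H; auto.
  - exists K. split; auto.
Qed.

(* The weight exp (L x) + exp (- L x) turns each Picard step into a contraction by 1/2. *)
Lemma picard_step_bound (alpha beta : R) :
  alpha <= t0 <= beta ->
  (forall t, alpha <= t <= beta -> D t) ->
  exists M, 0 < M /\ forall n i t, (i <= N)%nat -> alpha <= t <= beta ->
    Rabs (picard (S n) i t - picard n i t) <= M / 2 ^ n.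
Proof.
  intros H0 HD.
  destruct (coef_bound alpha beta HD) as (K & HK & HKb).
  destruct (finite_uniform_bound (fun i K => Rabs (c i) <= K) N) as (C & HC & HCb).
  { intros; lra. }
  { intros i _. exists (Rabs (c i)); lra. }
  assert (HN : 0 < INR (S N)) by (apply lt_0_INR; lia).
  set (B := INR (S N) * K). assert (HB : 0 < B) by (apply Rmult_lt_0_compat; auto).
  set (L := 2 * B).
  (* [psi] is the antiderivative of [phi] that vanishes at [t0], and its absolute value is at most
     [phi / L]. As [L = 2 * B], integrating the bound [B * (Q * phi)] gives [Q / 2 * phi]. *)
  set (phi := fun t => exp (L * (t - t0)) + exp (- (L * (t - t0)))).
  set (psi := fun t => (exp (L * (t - t0)) - exp (- (L * (t - t0)))) / L).
  assert (Hphi : forall t, 1 <= phi t).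
  { intros t. unfold phi. destruct (Rle_dec 0 (L * (t - t0))) as [h | h].
    - pose proof (exp_pos (- (L * (t - t0)))).
      pose proof (exp_ineq1_le (L * (t - t0))). lra.
    - pose proof (exp_pos (L * (t - t0))).
      pose proof (exp_ineq1_le (- (L * (t - t0)))). lra. }
  assert (Hpsi : forall t, Rabs (psi t) <= phi t / L).
  { intros t. unfold psi, phi, Rdiv. rewrite Rabs_mult.
    assert (0 < / L) by (apply Rinv_0_lt_compat; unfold L; lra).
    rewrite (Rabs_right (/ L)) by lra.
    apply Rmult_le_compat_r; [lra |].
    pose proof (exp_pos (L * (t - t0))). pose proof (exp_pos (- (L * (t - t0)))).
    apply Rabs_le. lra. }
  assert (Hstep : forall (d d' : R -> R) Q, 0 <= Q -> d t0 = 0 ->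
    (forall t, alpha <= t <= beta -> is_derive d t (d' t)) ->
    (forall t, alpha <= t <= beta -> Rabs (d' t) <= B * (Q * phi t)) ->
    forall t, alpha <= t <= beta -> Rabs (d t) <= Q / 2 * phi t).
  { intros d d' Q HQ Hd0 Hd Hd' t Ht.
    apply Rle_trans with (Rabs (B * Q * psi t)).
    - apply (abs_le_of_derive d d' (fun t => B * Q * psi t) (fun t => B * Q * phi t) t0 t).
      + intros x Hx.
        assert (Hx' : alpha <= x <= beta).
        { revert Hx. unfold Rmin, Rmax. destruct (Rle_dec t0 t); lra. }
        split; [auto | split].
        * unfold psi, phi. auto_derive; [exact I |]. unfold Rminus. field. unfold L; lra.
        * rewrite Rmult_assoc. auto.
      + exact Hd0.
      + unfold psi. rewrite Rminus_diag, Rmult_0_r, Ropp_0, Rminus_diag. unfold Rdiv. ring.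
    - rewrite Rabs_mult, (Rabs_right (B * Q)) by nra.
      apply Rle_trans with (B * Q * (phi t / L)).
      + apply Rmult_le_compat_l; [nra | auto].
      + right. unfold L. field. lra. }
  (* The first increment has derivative at most [B * C], hence at most [B * (C * phi t)] because
     [phi >= 1]; every later step halves the bound. *)
  assert (Hmain : forall n i t, (i <= N)%nat -> alpha <= t <= beta ->
    Rabs (picard (S n) i t - picard n i t) <= C / 2 ^ n * phi t).
  { induction n as [|n IH]; intros i t Hi Ht.
    - apply Rle_trans with (C / 2 * phi t).
      2: { apply Rmult_le_compat_r; [pose proof (Hphi t); lra |]. simpl; lra. }
      revert t Ht. apply (Hstep _ (fun t => mulmv N (fun i j => a i j t) c i)).
      + lra.
      + rewrite !picard_init; ring.
      + intros t Ht.
        rewrite <- (Rminus_0_r (mulmv _ _ _ _)).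
        apply (is_derive_minus (V := R_NormedModule)).
        * apply (is_derive_picard 0); auto.
        * apply @is_derive_const.
      + intros t Ht. eapply Rle_trans.
        * apply (mulmv_bound _ _ _ _ K C); auto.
        * fold B. apply Rmult_le_compat_l; [lra |]. pose proof (Hphi t). nra.
    - replace (C / 2 ^ S n * phi t) with (C / 2 ^ n / 2 * phi t).
      2: { simpl. field. apply pow_nonzero; lra. }
      revert t Ht.
      assert (Hp : 0 < 2 ^ n) by (apply pow_lt; lra).
      apply (Hstep _ (fun t => mulmv N (fun i j => a i j t)
                       (fun j => picard (S n) j t - picard n j t) i)).
      + apply Rlt_le, Rdiv_lt_0_compat; auto.
      + rewrite !picard_init; ring.
      + intros t Ht. rewrite mulmv_minus.
        apply (is_derive_minus (V := R_NormedModule)); apply is_derive_picard; auto.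
      + intros t Ht. apply (mulmv_bound _ _ _ _ K); auto. }
  exists (C * (exp (L * (beta - t0)) + exp (L * (t0 - alpha)))). split.
  - pose proof (exp_pos (L * (beta - t0))). pose proof (exp_pos (L * (t0 - alpha))). nra.
  - intros n i t Hi Ht. eapply Rle_trans; [apply Hmain; auto |].
    replace (C / 2 ^ n * phi t) with (C * phi t / 2 ^ n) by (unfold Rdiv; ring).
    unfold Rdiv. apply Rmult_le_compat_r.
    + apply Rlt_le, Rinv_0_lt_compat, pow_lt; lra.
    + apply Rmult_le_compat_l; [lra |]. unfold phi.
      apply Rplus_le_compat; apply exp_monotone; unfold L; nra.
Qed.

Lemma picard_cauchy (alpha beta : R) (i : nat) :
  (i <= N)%nat -> alpha <= t0 <= beta ->
  (forall t, alpha <= t <= beta -> D t) ->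
  CVU_dom (fun n t => picard n i t) (fun t => alpha < t < beta).
Proof.
  intros Hi H0 HD. apply CVU_dom_cauchy. intros eps.
  destruct (picard_step_bound alpha beta H0 HD) as (M & HM & HMb).
  (* The geometric tail in telescoped form: keeping the subtracted term is what closes the induction
     on [k]. *)
  assert (Hk : forall n k t, alpha <= t <= beta ->
    Rabs (picard (n + k) i t - picard n i t) <= 2 * M / 2 ^ n - 2 * M / 2 ^ (n + k)).
  { intros n k t Ht. induction k as [|k IH].
    - rewrite Nat.add_0_r, !Rminus_diag, Rabs_R0. lra.
    - rewrite Nat.add_succ_r.
      replace (picard (S (n + k)) i t - picard n i t) with
        ((picard (S (n + k)) i t - picard (n + k) i t)
         + (picard (n + k) i t - picard n i t)) by ring.
      eapply Rle_trans; [apply Rabs_triang |].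
      pose proof (HMb (n + k)%nat i t Hi Ht).
      replace (2 * M / 2 ^ S (n + k)) with (M / 2 ^ (n + k)).
      2: { simpl. field. apply pow_nonzero; lra. }
      assert (2 * M / 2 ^ (n + k) = 2 * (M / 2 ^ (n + k))) by (unfold Rdiv; ring).
      lra. }
  assert (Hle : forall n k t, alpha <= t <= beta ->
    Rabs (picard (n + k) i t - picard n i t) <= 2 * M * (/ 2) ^ n).
  { intros n k t Ht. eapply Rle_trans; [apply Hk; auto |].
    rewrite pow_inv.
    assert (0 < 2 * M / 2 ^ (n + k)).
    { apply Rdiv_lt_0_compat; [lra | apply pow_lt; lra]. }
    unfold Rdiv in *. lra. }
  destruct (pow_lt_1_zero (/ 2) ltac:(rewrite Rabs_right; lra) (eps / (4 * M)))
    as (n0 & Hn0).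
  { apply Rdiv_lt_0_compat; [apply cond_pos | lra]. }
  exists n0.
  assert (Hb : forall n t, alpha < t < beta -> (n0 <= n)%nat ->
    Rabs (picard n i t - picard n0 i t) < eps / 2).
  { intros n t Ht Hn. replace n with (n0 + (n - n0))%nat by lia.
    eapply Rle_lt_trans; [apply Hle; lra |].
    specialize (Hn0 n0 (Nat.le_refl n0)).
    rewrite Rabs_right in Hn0 by (apply Rle_ge, pow_le; lra).
    apply Rlt_le_trans with (2 * M * (eps / (4 * M))).
    - apply Rmult_lt_compat_l; lra.
    - right. field. lra. }
  intros n m t Ht Hn Hm.
  replace (picard n i t - picard m i t) with
    ((picard n i t - picard n0 i t) - (picard m i t - picard n0 i t)) by ring.
  eapply Rle_lt_trans; [apply Rabs_triang |]. rewrite Rabs_Ropp.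
  pose proof (Hb n t Ht Hn). pose proof (Hb m t Ht Hm). lra.
Qed.

Lemma lin_sol_init (i : nat) : lin_sol i t0 = c i.
Proof.
  unfold lin_sol. rewrite (Lim_seq_ext _ (fun _ => c i)).
  - now rewrite Lim_seq_const.
  - intros n. apply picard_init.
Qed.

Lemma is_lim_picard (i : nat) (t : R) : (i <= N)%nat -> D t ->
  is_lim_seq (fun n => picard n i t) (lin_sol i t).
Proof.
  intros Hi Ht.
  destruct (open_convex_compact D t0 t) as (al & be & H1 & H2 & H3); auto.
  apply Lim_seq_correct'.
  apply (CVU_CVS_dom _ _ (picard_cauchy al be i Hi ltac:(lra) H3)). lra.
Qed.

(** The derivatives of the iterates are the matrix applied to the previous iterates, so they
    converge uniformly because the iterates do, and limit and derivative may be exchanged. The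
    sequence is shifted to [picard (S n)], for which the derivative has this form. *)
Lemma is_derive_lin_sol (i : nat) (t : R) : (i <= N)%nat -> D t ->
  is_derive (lin_sol i) t
    (mulmv N (fun i j => a i j t) (fun j => lin_sol j t) i).
Proof.
  intros Hi Ht.
  destruct (open_convex_compact D t0 t) as (al & be & H1 & H2 & H3); auto.
  destruct (coef_bound al be H3) as (K & HK & HKb).
  assert (HN : 0 < INR (S N)) by (apply lt_0_INR; lia).
  assert (Hcv : forall j, (j <= N)%nat ->
    CVU_dom (fun n t => picard n j t) (fun t => al < t < be)).
  { intros j Hj. apply picard_cauchy; auto. lra. }
  set (Dab := fun t => al < t < be).
  assert (Hopen : open Dab) by (apply open_and; [apply open_gt | apply open_lt]).
  assert (HDer : forall n x, Dab x -> Derive (picard (S n) i) x =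
    mulmv N (fun i j => a i j x) (fun j => picard n j x) i).
  { intros n x Hx. apply is_derive_unique, is_derive_picard; auto. apply H3.
    unfold Dab in Hx; lra. }
  assert (HU := CVU_Derive (fun n => picard (S n) i) Dab Hopen).
  assert (Hlim : forall x, Dab x ->
    Lim_seq (fun n => Derive (picard (S n) i) x) =
    mulmv N (fun i j => a i j x) (fun j => lin_sol j x) i).
  { intros x Hx. rewrite (Lim_seq_ext _ _ (fun n => HDer n x Hx)).
    apply is_lim_seq_unique. unfold mulmv.
    assert (Hj : forall m, (m <= N)%nat ->
      is_lim_seq (fun n => sum_f_R0 (fun j => a i j x * picard n j x) m)
        (sum_f_R0 (fun j => a i j x * lin_sol j x) m)).
    { induction m as [|m IH]; intros Hm; simpl.
      - apply (is_lim_seq_scal_l _ _ (lin_sol 0 x)). apply is_lim_picard; auto.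
        apply H3; unfold Dab in Hx; lra.
      - apply is_lim_seq_plus'; [apply IH; lia |].
        apply (is_lim_seq_scal_l _ _ (lin_sol (S m) x)). apply is_lim_picard; auto.
        apply H3; unfold Dab in Hx; lra. }
    apply Hj; lia. }
  replace (mulmv N (fun i j => a i j t) (fun j => lin_sol j t) i)
    with (real (Lim_seq (fun n => Derive (picard (S n) i) t))).
  2: { rewrite Hlim; [reflexivity |]. unfold Dab; lra. }
  apply (is_derive_ext (fun t => real (Lim_seq (fun n => picard (S n) i t)))).
  { intros x. unfold lin_sol. f_equal.
    apply (Lim_seq_incr_1 (fun n => picard n i x)). }
  apply HU; clear HU.
  - intros x y z Hx Hy Hz. unfold Dab in *. lra.
  - apply CVU_dom_cauchy. intros eps.
    destruct (proj1 (CVU_dom_cauchy _ _) (Hcv i Hi) eps) as (n0 & H).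
    exists n0. intros n m x Hx Hn Hm. apply H; auto; lia.
  - intros n x Hx. eexists. apply is_derive_picard; auto. apply H3; unfold Dab in Hx; lra.
  - intros n x Hx. apply continuity_pt_filterlim.
    apply (continuous_ext_loc (T := R_UniformSpace) (U := R_UniformSpace)
      (Derive (picard (S n) i)) (fun x => mulmv N (fun i j => a i j x) (fun j => picard n j x) i)).
    + apply (filter_imp Dab); [| apply Hopen, Hx]. intros y Hy. symmetry; auto.
    + apply continuous_mulmv; intros; [apply Ha | apply continuous_picard]; auto;
        apply H3; unfold Dab in Hx; lra.
  - apply CVU_dom_cauchy. intros eps.
    (* The factor 2 makes the nonstrict estimate of [mulmv_bound] equal to [eps / 2], hence strictly
       below [eps]. *)
    assert (Hc0 : forall j, (j <= N)%nat -> exists n0, forall n m x, Dab x ->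
      (n0 <= n)%nat -> (n0 <= m)%nat ->
      Rabs (picard n j x - picard m j x) < eps / (2 * (INR (S N) * K))).
    { intros j Hj.
      assert (He : 0 < eps / (2 * (INR (S N) * K))).
      { apply Rdiv_lt_0_compat; [apply cond_pos | nra]. }
      apply (proj1 (CVU_dom_cauchy _ _) (Hcv j Hj) (mkposreal _ He)). }
    assert (Hu : forall m, (m <= N)%nat -> exists n0, forall j, (j <= m)%nat ->
      forall n m x, Dab x -> (n0 <= n)%nat -> (n0 <= m)%nat ->
      Rabs (picard n j x - picard m j x) < eps / (2 * (INR (S N) * K))).
    { induction m as [|m IH]; intros Hm.
      - destruct (Hc0 0%nat ltac:(lia)) as (n0 & H). exists n0.
        intros j Hj. replace j with 0%nat by lia. exact H.
      - destruct IH as (n1 & Hn1); [lia |].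
        destruct (Hc0 (S m) Hm) as (n2 & Hn2).
        exists (n1 + n2)%nat. intros j Hj.
        destruct (Nat.eq_dec j (S m)) as [-> |].
        + intros; apply Hn2; auto; lia.
        + intros; apply Hn1; auto; lia. }
    destruct (Hu N (Nat.le_refl N)) as (n0 & H).
    exists n0. intros n m x Hx Hn Hm.
    rewrite !HDer, <- mulmv_minus by auto.
    eapply Rle_lt_trans.
    + apply (mulmv_bound _ _ _ _ K (eps / (2 * (INR (S N) * K)))).
      * intros; apply HKb; auto. unfold Dab in Hx; lra.
      * intros j Hj. left. apply H; auto.
    + pose proof (cond_pos eps).
      replace (INR (S N) * K * (eps / (2 * (INR (S N) * K)))) with (eps / 2).
      * lra.
      * field. split; lra.
  - unfold Dab; lra.
Qed.

End LinearODE.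

(** * Gronwall's inequality and uniqueness for linear systems *)

Lemma filter_forall_le {T : Type} (F : (T -> Prop) -> Prop) {FF : Filter F}
  (P : nat -> T -> Prop) (N : nat) :
  (forall i, (i <= N)%nat -> F (P i)) ->
  F (fun x => forall i, (i <= N)%nat -> P i x).
Proof.
  induction N as [|N IH]; intros H.
  - apply (filter_imp (P 0%nat)); [| apply H; lia].
    intros x Hx i Hi. now replace i with 0%nat by lia.
  - apply (filter_imp (fun x => (forall i, (i <= N)%nat -> P i x) /\ P (S N) x)).
    + intros x [H1 H2] i Hi. destruct (Nat.eq_dec i (S N)) as [-> |]; [easy |].
      apply H1; lia.
    + apply filter_and; [apply IH; intros |]; apply H; lia.
Qed.

(** The integrating factor depends on the side of [t0]: [(E + d) exp (- K (x - t0))] is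
    nonincreasing to the right, and [(E + d) exp (K (x - t0))] is nondecreasing to the left. *)
Lemma gronwall (E E' : R -> R) (K d a b t0 : R) :
  (forall t, a <= t <= b -> is_derive E t (E' t)) ->
  (forall t, a <= t <= b -> Rabs (E' t) <= K * (E t + d)) ->
  a <= t0 <= b -> forall t, a <= t <= b ->
  E t + d <= (E t0 + d) * exp (K * Rabs (t - t0)).
Proof.
  intros HE HE' H0 t Ht.
  assert (Hmul : forall x y k, x * exp (- k) <= y -> x <= y * exp k).
  { intros x y k H. replace x with (x * exp (- k) * exp k).
    - apply Rmult_le_compat_r; [left; apply exp_pos | exact H].
    - rewrite Rmult_assoc, <- exp_plus, Rplus_opp_l, exp_0. ring. }
  assert (Habs : forall x, a <= x <= b -> - (K * (E x + d)) <= E' x <= K * (E x + d)).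
  { intros x Hx. apply Rabs_le_between. auto. }
  apply Hmul. destruct (Rle_dec t0 t) as [Hl | Hl].
  - rewrite Rabs_right by lra.
    assert (H := nondecreasing_of_derive
      (fun x => - ((E x + d) * exp (- (K * (x - t0)))))
      (fun x => - ((E' x - K * (E x + d)) * exp (- (K * (x - t0))))) t0 t Hl).
    cbv beta in H. rewrite Rminus_diag, Rmult_0_r, Ropp_0, exp_0 in H.
    assert (- ((E t0 + d) * 1) <= - ((E t + d) * exp (- (K * (t - t0))))); [| lra].
    apply H.
    + intros x Hx. assert (Hd := HE x ltac:(lra)).
      auto_derive; [now exists (E' x) |].
      replace (Derive (fun x : R => E x) x) with (E' x)
        by (symmetry; apply is_derive_unique, Hd). unfold Rminus. ring.
    + intros x Hx. pose proof (Habs x ltac:(lra)).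
      pose proof (exp_pos (- (K * (x - t0)))). nra.
  - rewrite Rabs_left by lra.
    assert (H := nondecreasing_of_derive
      (fun x => (E x + d) * exp (K * (x - t0)))
      (fun x => (E' x + K * (E x + d)) * exp (K * (x - t0))) t t0 ltac:(lra)).
    cbv beta in H. rewrite Rminus_diag, Rmult_0_r, exp_0 in H.
    replace (- (K * - (t - t0))) with (K * (t - t0)) by ring.
    rewrite Rmult_1_r in H. apply H.
    + intros x Hx. assert (Hd := HE x ltac:(lra)).
      auto_derive; [now exists (E' x) |].
      replace (Derive (fun x : R => E x) x) with (E' x)
        by (symmetry; apply is_derive_unique, Hd). unfold Rminus. ring.
    + intros x Hx. pose proof (Habs x ltac:(lra)).
      pose proof (exp_pos (K * (x - t0))). nra.
Qed.

Lemma sum_switch (f : nat -> nat -> R) (n m : nat) :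
  sum_f_R0 (fun i => sum_f_R0 (fun j => f i j) m) n
  = sum_f_R0 (fun j => sum_f_R0 (fun i => f i j) n) m.
Proof.
  induction n as [|n IH]; simpl; [reflexivity |].
  rewrite IH, <- plus_sum. reflexivity.
Qed.

Lemma sum_f_R0_term_le (f : nat -> R) (N i : nat) :
  (forall j, 0 <= f j) -> (i <= N)%nat -> f i <= sum_f_R0 f N.
Proof.
  intros Hf Hi. induction N as [|N IH].
  - replace i with 0%nat by lia. simpl; lra.
  - simpl. pose proof (Hf (S N)). destruct (Nat.eq_dec i (S N)) as [-> |].
    + pose proof (cond_pos_sum f N Hf). lra.
    + pose proof (IH ltac:(lia)). lra.
Qed.

(** The order of quantifiers matters: [C] depends only on [N], [K] and the interval, so one constant
    serves a whole family of matrices. The proof applies [gronwall] to the sum of squares, which is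
    differentiable where a norm need not be. *)
Lemma lin_gronwall (N : nat) (K a b t0 : R) :
  0 <= K -> a <= t0 <= b ->
  exists C, 0 < C /\
  forall (A : nat -> nat -> R -> R) (g y : nat -> R -> R) (e : R), 0 <= e ->
  (forall i t, (i <= N)%nat -> a <= t <= b ->
     is_derive (y i) t (mulmv N (fun i j => A i j t) (fun j => y j t) i + g i t)) ->
  (forall i j t, (i <= N)%nat -> (j <= N)%nat -> a <= t <= b -> Rabs (A i j t) <= K) ->
  (forall i t, (i <= N)%nat -> a <= t <= b -> Rabs (g i t) <= e) ->
  (forall i, (i <= N)%nat -> Rabs (y i t0) <= e) ->
  forall i t, (i <= N)%nat -> a <= t <= b -> Rabs (y i t) <= C * e.
Proof.
  intros HK H0.
  assert (HN : 1 <= INR (S N)) by (rewrite S_INR; pose proof (pos_INR N); lra).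
  (* The matrix contributes 2 K |y_i| |y_j| <= K (y_i^2 + y_j^2), which sums to
     [2 * (INR (S N) * K)] times the energy. The summand 1 and the shift [INR (S N) * (e * e)] come
     from 2 |y_i| |g_i| <= y_i^2 + e^2. *)
  set (k := 2 * (INR (S N) * K) + 1).
  assert (Hk : 1 <= k) by (unfold k; nra).
  set (C := 2 * INR (S N) * exp (k * (b - a))).
  assert (HC : 1 <= C).
  { unfold C. pose proof (exp_ineq1_le (k * (b - a))).
    assert (0 <= k * (b - a)) by nra. nra. }
  exists C. split; [lra |].
  intros A g y e He Hy HA Hg Hinit i t Hi Ht.
  set (E := fun t => sum_f_R0 (fun i => y i t * y i t) N).
  set (E' := fun t => sum_f_R0 (fun i => 2 * (y i t *
    (mulmv N (fun i j => A i j t) (fun j => y j t) i + g i t))) N).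
  assert (HE : forall t, a <= t <= b -> is_derive E t (E' t)).
  { intros x Hx. apply (is_derive_sum_f_R0 (fun i x => y i x * y i x)).
    intros j Hj. assert (Hd := Hy j x Hj Hx).
    auto_derive; [repeat split; now eexists; exact Hd |].
    rewrite (is_derive_unique (fun x : R => y j x : R) _ _ Hd
      : Derive (fun x : R => y j x) x = _). ring. }
  assert (HE' : forall t, a <= t <= b -> Rabs (E' t) <= k * (E t + INR (S N) * (e * e))).
  { intros x Hx. unfold E'. eapply Rle_trans; [apply Rsum_abs |].
    apply Rle_trans with (sum_f_R0 (fun i => sum_f_R0 (fun j =>
      K * (y i x * y i x) + K * (y j x * y j x)) N + (y i x * y i x + e * e)) N).
    - apply sum_Rle. intros l Hl. unfold mulmv.
      rewrite Rabs_mult, (Rabs_right 2), Rmult_plus_distr_l by lra.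
      rewrite scal_sum. eapply Rle_trans.
      { apply Rmult_le_compat_l; [lra | apply Rabs_triang]. }
      rewrite Rmult_plus_distr_l. apply Rplus_le_compat.
      + eapply Rle_trans; [apply Rmult_le_compat_l; [lra | apply Rsum_abs] |].
        rewrite scal_sum. apply sum_Rle. intros j Hj. rewrite !Rabs_mult.
        pose proof (HA l j x Hl Hj Hx) as HAK.
        replace (y l x * y l x) with (Rabs (y l x) * Rabs (y l x)).
        2: { rewrite <- Rabs_mult. apply Rabs_right. nra. }
        replace (y j x * y j x) with (Rabs (y j x) * Rabs (y j x)).
        2: { rewrite <- Rabs_mult. apply Rabs_right. nra. }
        pose proof (Rabs_pos (y l x)). pose proof (Rabs_pos (y j x)).
        set (p := Rabs (y l x)) in *. set (q := Rabs (y j x)) in *.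
        set (r := Rabs (A l j x)) in *.
        apply Rle_trans with (K * (2 * (p * q))).
        * replace (r * q * p * 2) with (r * (2 * (p * q))) by ring.
          apply Rmult_le_compat_r; [nra | exact HAK].
        * rewrite <- Rmult_plus_distr_l. apply Rmult_le_compat_l; [lra |].
          pose proof (Rle_0_sqr (p - q)). unfold Rsqr in *. nra.
      + rewrite Rabs_mult. pose proof (Hg l x Hl Hx).
        replace (y l x * y l x) with (Rabs (y l x) * Rabs (y l x)).
        2: { rewrite <- Rabs_mult. apply Rabs_right. nra. }
        pose proof (Rabs_pos (y l x)). pose proof (Rabs_pos (g l x)).
        pose proof (Rle_0_sqr (Rabs (y l x) - e)). unfold Rsqr in *. nra.
    - rewrite plus_sum.
      assert (H1 : sum_f_R0 (fun i => sum_f_R0 (fun j =>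
        K * (y i x * y i x) + K * (y j x * y j x)) N) N = 2 * (INR (S N) * K) * E x).
      { rewrite (sum_eq _ (fun i => (y i x * y i x) * (INR (S N) * K) + K * E x)).
        - rewrite plus_sum, <- scal_sum, sum_cte. fold (E x). ring.
        - intros l _. rewrite plus_sum, sum_cte.
          unfold E. rewrite (scal_sum _ N K).
          rewrite (sum_eq (fun i => y i x * y i x * K) (fun i => K * (y i x * y i x)))
            by (intros; ring). ring. }
      rewrite H1, plus_sum, sum_cte. fold (E x).
      assert (0 <= e * e) by nra. unfold k.
      assert (0 <= INR (S N) * K * (INR (S N) * (e * e))).
      { apply Rmult_le_pos; apply Rmult_le_pos; lra. }
      lra. }
  pose proof (gronwall E E' k (INR (S N) * (e * e)) a b t0 HE HE' H0 t Ht) as HG.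
  assert (HE0 : E t0 <= INR (S N) * (e * e)).
  { unfold E. rewrite Rmult_comm, <- sum_cte. apply sum_Rle. intros j Hj.
    replace (y j t0 * y j t0) with (Rabs (y j t0) * Rabs (y j t0)).
    2: { rewrite <- Rabs_mult. apply Rabs_right. nra. }
    apply Rmult_le_compat; auto using Rabs_pos. }
  assert (Hyi : y i t * y i t <= E t).
  { apply (sum_f_R0_term_le (fun i => y i t * y i t)); auto. intros; nra. }
  assert (Hexp : exp (k * Rabs (t - t0)) <= exp (k * (b - a))).
  { apply exp_monotone. apply Rmult_le_compat_l; [lra |]. apply Rabs_le. lra. }
  assert (Hfin : y i t * y i t <= C * (e * e)).
  { assert (0 <= INR (S N) * (e * e)) by (apply Rmult_le_pos; nra).
    pose proof (exp_pos (k * Rabs (t - t0))).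
    apply Rle_trans with ((E t0 + INR (S N) * (e * e)) * exp (k * Rabs (t - t0))); [lra |].
    apply Rle_trans with ((2 * (INR (S N) * (e * e))) * exp (k * Rabs (t - t0))).
    - apply Rmult_le_compat_r; lra.
    - apply Rle_trans with ((2 * (INR (S N) * (e * e))) * exp (k * (b - a))).
      + apply Rmult_le_compat_l; lra.
      + right. unfold C. ring. }
  (* As [C >= 1], the bound [C * (e * e)] on the square is at most the square of [C * e]; no square
     root of [C] has to be taken. *)
  apply Rsqr_incr_0_var; [| nra].
  rewrite <- Rsqr_abs. unfold Rsqr.
  apply Rle_trans with (C * (e * e)); [exact Hfin |].
  assert (0 <= e * e) by nra. nra.
Qed.

(** This is [lin_gronwall] with [e = 0]. *)
Lemma lin_ode_unique (N : nat) (A : nat -> nat -> R -> R) (y : nat -> R -> R)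
  (t0 : R) (D : R -> Prop) :
  open D -> convex D -> D t0 ->
  (forall i j t, (i <= N)%nat -> (j <= N)%nat -> D t -> continuous (A i j) t) ->
  (forall i t, (i <= N)%nat -> D t ->
     is_derive (y i) t (mulmv N (fun i j => A i j t) (fun j => y j t) i)) ->
  (forall i, (i <= N)%nat -> y i t0 = 0) ->
  forall i t, (i <= N)%nat -> D t -> y i t = 0.
Proof.
  intros Ho Hc H0 HA Hy Hi0 i t Hi Ht.
  destruct (open_convex_compact D t0 t) as (a & b & H1 & H2 & H3); auto.
  destruct (coef_bound N A D HA a b H3) as (K & HK & HKb).
  destruct (lin_gronwall N K a b t0) as (C & HC & HG); [lra | lra |].
  assert (Hz : Rabs (y i t) <= C * 0).
  { apply (HG A (fun _ _ => 0) y 0); auto; try lra.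
    - intros j x Hj Hx. rewrite Rplus_0_r. auto.
    - intros. rewrite Rabs_R0. lra.
    - intros j Hj. rewrite Hi0, Rabs_R0 by auto. lra. }
  pose proof (Rabs_pos (y i t)). apply Rabs_eq_0. lra.
Qed.

(** * Frobenius theorem for linear systems in two variables *)

Definition mulmm (N : nat) (a b : nat -> nat -> R) (i k : nat) : R :=
  sum_f_R0 (fun j => a i j * b j k) N.

Lemma mulmv_assoc (N : nat) (a b : nat -> nat -> R) (y : nat -> R) (i : nat) :
  mulmv N a (mulmv N b y) i = mulmv N (mulmm N a b) y i.
Proof.
  unfold mulmv, mulmm.
  rewrite (sum_eq _ (fun j => sum_f_R0 (fun k => a i j * b j k * y k) N)).
  - rewrite sum_switch. apply sum_eq. intros k _.
    rewrite Rmult_comm, scal_sum. reflexivity.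
  - intros j _. rewrite scal_sum. apply sum_eq. intros; ring.
Qed.

Lemma is_derive_mulmv (N : nat) (a : nat -> nat -> R -> R) (y : nat -> R -> R)
  (a' : nat -> nat -> R) (y' : nat -> R) (i : nat) (x : R) :
  (forall j, (j <= N)%nat -> is_derive (a i j) x (a' i j)) ->
  (forall j, (j <= N)%nat -> is_derive (y j) x (y' j)) ->
  is_derive (fun x => mulmv N (fun i j => a i j x) (fun j => y j x) i) x
    (mulmv N a' (fun j => y j x) i + mulmv N (fun i j => a i j x) y' i).
Proof.
  intros Ha Hy. unfold mulmv. rewrite <- plus_sum.
  apply (is_derive_sum_f_R0 (fun j x => a i j x * y j x)). intros j Hj.
  apply (is_derive_mult (K := R_AbsRing) (a i j) (y j)); auto.
  intros; apply Rmult_comm.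
Qed.

Lemma Ck_S_down (k : nat) (U : R -> R -> Prop) (f : R -> R -> R) :
  Ck (S k) U f -> Ck k U f.
Proof. intros H; apply H. Qed.

Lemma Ck_0 (k : nat) (U : R -> R -> Prop) (f : R -> R -> R) :
  Ck k U f -> Ck 0 U f.
Proof. induction k; [easy |]. intros H; apply IHk, H. Qed.

Lemma Ck_0_continuous_fst (U : R -> R -> Prop) (f : R -> R -> R) (x y : R) :
  Ck 0 U f -> U x y -> continuous (fun s => f s y) x.
Proof.
  intros H HU. apply (continuous_comp_2 (fun s => s) (fun _ => y) f).
  - apply continuous_id.
  - apply continuous_const.
  - apply H, HU.
Qed.

Lemma Ck_0_continuous_snd (U : R -> R -> Prop) (f : R -> R -> R) (x y : R) :
  Ck 0 U f -> U x y -> continuous (fun t => f x t) y.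
Proof.
  intros H HU. apply (continuous_comp_2 (fun _ => x) (fun t => t) f).
  - apply continuous_const.
  - apply continuous_id.
  - apply H, HU.
Qed.

Lemma ball_0_Rabs (h d : R) : ball (M := R_UniformSpace) 0 d h <-> Rabs h < d.
Proof.
  change (ball (M := R_UniformSpace) 0 d h) with (Rabs (h - 0) < d).
  now rewrite Rminus_0_r.
Qed.

Lemma locally_0_uniform_continuity (f : R -> R -> R) (s a b e : R) :
  (forall t, a <= t <= b ->
     continuous (fun p : R * R => f (fst p) (snd p)) (s, t)) ->
  0 < e ->
  locally 0 (fun h => forall t, a <= t <= b -> Rabs (f (s + h) t - f s t) <= e).
Proof.
  intros Hf He.
  destruct (uniform_continuity_2d_1d' f a b s) with (eps := mkposreal e He) as [d Hd].
  { intros t Ht. apply continuity_2d_pt_filterlim. apply Hf, Ht. }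
  exists d. intros h Hh t Ht. simpl in h.
  assert (H : Rabs h < d) by (apply ball_0_Rabs; exact Hh).
  apply Rabs_lt_between in H. pose proof (cond_pos d).
  left. apply (Hd t s t (s + h)); try lra.
  rewrite Rminus_diag, Rabs_R0. lra.
Qed.

(** By the mean value theorem the remainder is [h] times the variation of [dx f] between [s] and an
    intermediate point, which is small uniformly in [t]. *)
Lemma locally_0_uniform_derive (U : R -> R -> Prop) (f : R -> R -> R) (s a b e : R) :
  Ck 1 U f -> (forall x t, a <= t <= b -> U x t) -> 0 < e ->
  locally 0 (fun h => forall t, a <= t <= b ->
    Rabs (f (s + h) t - f s t - h * dx f s t) <= e * Rabs h).
Proof.
  intros (Hd & H0 & H1 & _) HU He.
  assert (Hc : forall t, a <= t <= b ->
    continuous (fun p : R * R => dx f (fst p) (snd p)) (s, t)).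
  { intros t Ht. apply H1, HU, Ht. }
  destruct (locally_0_uniform_continuity (dx f) s a b e Hc He) as [d Hu].
  exists d. intros h Hh t Ht. simpl in h.
  assert (Hhd : Rabs h < d) by (apply ball_0_Rabs; exact Hh).
  destruct (MVT_gen (fun x => f x t) s (s + h) (fun x => dx f x t)) as (c & Hcc & E).
  - intros x Hx. apply Derive_correct. apply Hd, HU, Ht.
  - intros x Hx. apply continuity_pt_filterlim.
    apply (Ck_0_continuous_fst U f); auto.
  - rewrite E. replace (s + h - s) with h by ring.
    replace (dx f c t * h - h * dx f s t) with ((dx f (s + (c - s)) t - dx f s t) * h).
    2: { replace (s + (c - s)) with c by ring. ring. }
    rewrite Rabs_mult. apply Rmult_le_compat_r; [apply Rabs_pos |].
    apply Hu; auto. apply ball_0_Rabs.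
    apply Rle_lt_trans with (Rabs h); [| exact Hhd].
    revert Hcc. unfold Rmin, Rmax. destruct (Rle_dec s (s + h)); intros Hcc.
    + rewrite !Rabs_right; lra.
    + rewrite (Rabs_left h) by lra. apply Rabs_le. lra.
Qed.

Section Frobenius.

Variables (N : nat) (A B : nat -> nat -> R -> R -> R) (D : R -> Prop) (t0 : R).
Let U (s t : R) : Prop := D t.
Hypotheses (HDo : open D) (HDc : convex D) (HD0 : D t0)
  (HA : forall i j, (i <= N)%nat -> (j <= N)%nat -> Ck 1 U (A i j))
  (HB : forall i j, (i <= N)%nat -> (j <= N)%nat -> Ck 1 U (B i j))
  (Hcompat : forall i j s t, (i <= N)%nat -> (j <= N)%nat -> D t ->
     dy (A i j) s t
       + mulmm N (fun i j => A i j s t) (fun i j => B i j s t) i j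
     = dx (B i j) s t
       + mulmm N (fun i j => B i j s t) (fun i j => A i j s t) i j).

(** For y_s = A y and y_t = B y, equality of the mixed derivatives reads (A_t + A B) y = (B_s + B A)
    y. [Hcompat] asks for this identity at the level of the matrices. *)
Definition integral_surface (y : nat -> R -> R -> R) : Prop :=
  forall i s t, (i <= N)%nat -> D t ->
    is_derive (fun s => y i s t) s
      (mulmv N (fun i j => A i j s t) (fun j => y j s t) i) /\
    is_derive (fun t => y i s t) t
      (mulmv N (fun i j => B i j s t) (fun j => y j s t) i).

Definition base_sol (c : nat -> R) (i : nat) (s : R) : R :=
  lin_sol N (fun i j s => A i j s t0) c 0 i s.

Definition frob_sol (c : nat -> R) (i : nat) (s t : R) : R :=
  lin_sol N (fun i j t => B i j s t) (fun i => base_sol c i s) t0 i t.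

Lemma continuous_A_fst (i j : nat) (s t : R) : (i <= N)%nat -> (j <= N)%nat -> D t ->
  continuous (fun s => A i j s t) s.
Proof. intros Hi Hj Ht. apply (Ck_0_continuous_fst U); auto. apply HA; auto. Qed.

Lemma continuous_A_snd (i j : nat) (s t : R) : (i <= N)%nat -> (j <= N)%nat -> D t ->
  continuous (fun t => A i j s t) t.
Proof. intros Hi Hj Ht. apply (Ck_0_continuous_snd U); auto. apply HA; auto. Qed.

Lemma continuous_B_snd (i j : nat) (s t : R) : (i <= N)%nat -> (j <= N)%nat -> D t ->
  continuous (fun t => B i j s t) t.
Proof. intros Hi Hj Ht. apply (Ck_0_continuous_snd U); auto. apply HB; auto. Qed.

Lemma base_sol_derive (c : nat -> R) (i : nat) (s : R) : (i <= N)%nat ->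
  is_derive (base_sol c i) s
    (mulmv N (fun i j => A i j s t0) (fun j => base_sol c j s) i).
Proof.
  intros Hi. apply (is_derive_lin_sol N (fun i j s => A i j s t0) c 0 (fun _ => True)); auto.
  - apply open_true.
  - intros x y z; auto.
  - intros j k x Hj Hk _. apply continuous_A_fst; auto.
Qed.

Lemma frob_sol_t0 (c : nat -> R) (i : nat) (s : R) : frob_sol c i s t0 = base_sol c i s.
Proof. apply (lin_sol_init N _ (fun i => base_sol c i s) t0). Qed.

Lemma frob_sol_dt (c : nat -> R) (i : nat) (s t : R) : (i <= N)%nat -> D t ->
  is_derive (fun t => frob_sol c i s t) t
    (mulmv N (fun i j => B i j s t) (fun j => frob_sol c j s t) i).
Proof.
  intros Hi Ht.
  apply (is_derive_lin_sol N (fun i j t => B i j s t) _ t0 D); auto.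
  intros j k x Hj Hk Hx. apply continuous_B_snd; auto.
Qed.

Lemma vec_bound (y : nat -> R -> R) (a b : R) :
  (forall i t, (i <= N)%nat -> a <= t <= b -> continuous (y i) t) ->
  exists K, 0 < K /\ forall i, (i <= N)%nat -> forall t, a <= t <= b -> Rabs (y i t) <= K.
Proof.
  intros Hy.
  apply (finite_uniform_bound (fun i K => forall t, a <= t <= b -> Rabs (y i t) <= K)).
  - intros i K K' HK H t Ht. apply Rle_trans with K; auto.
  - intros i Hi. destruct (bounded_continuity (y i) a b) as [M HM].
    + intros x Hx. apply Hy; auto.
    + exists M. intros t Ht. left. apply (HM t Ht).
Qed.

(* By compatibility the remainder y(s+h) - y(s) - h A y(s) solves a linear equation in t
   whose inhomogeneity and initial value are o(h), so it is o(h) by Gronwall. *)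
Lemma frob_sol_expansion (c : nat -> R) (s a b e : R) :
  a <= t0 <= b -> (forall t, a <= t <= b -> D t) -> 0 < e ->
  locally 0 (fun h => forall i t, (i <= N)%nat -> a <= t <= b ->
    Rabs (frob_sol c i (s + h) t - frob_sol c i s t
          - h * mulmv N (fun i j => A i j s t) (fun j => frob_sol c j s t) i)
    <= e * Rabs h).
Proof.
  intros H0 HD He.
  set (y := frob_sol c).
  set (z := fun i t => mulmv N (fun i j => A i j s t) (fun j => y j s t) i).
  assert (Hyc : forall i t, (i <= N)%nat -> a <= t <= b -> continuous (fun t => y i s t) t).
  { intros i t Hi Ht. apply (ex_derive_continuous (fun t => y i s t)).
    eexists. apply frob_sol_dt; auto. }
  destruct (vec_bound (fun i t => y i s t) a b Hyc) as (Y & HY & HYb).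
  destruct (vec_bound z a b) as (Z & HZ & HZb).
  { intros i t Hi Ht. apply continuous_mulmv; intros; auto. apply continuous_A_snd; auto. }
  destruct (coef_bound N (fun i j t => B i j s t) D) with (alpha := a) (beta := b)
    as (K & HK & HKb); auto.
  { intros; apply continuous_B_snd; auto. }
  (* The matrix of the remainder is [B] at [s + h]; it stays below [K + 1] for small [h] because
     [e1 <= 1]. *)
  destruct (lin_gronwall N (K + 1) a b t0) as (C & HC & HG); [lra | lra |].
  assert (HN : 1 <= INR (S N)) by (rewrite S_INR; pose proof (pos_INR N); lra).
  (* [M * e1 * Rabs h] bounds the inhomogeneity [g]; the summand 1 makes [M >= 1], so that it bounds
     the initial error [e1 * Rabs h] as well. [e1] is then chosen to give [C * (M * e1) <= e]. *)
  set (M := INR (S N) * (Y + Z) + 1).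
  assert (HM : 1 <= M) by (unfold M; nra).
  set (e1 := Rmin 1 (e / (C * M))).
  assert (Hq : 0 < e / (C * M)) by (apply Rdiv_lt_0_compat; nra).
  assert (He1 : 0 < e1) by (apply Rmin_pos; lra).
  assert (He1' : e1 <= 1) by apply Rmin_l.
  assert (He1'' : C * (M * e1) <= e).
  { apply Rle_trans with (C * (M * (e / (C * M)))).
    - apply Rmult_le_compat_l; [lra |]. apply Rmult_le_compat_l; [lra | apply Rmin_r].
    - right. field. split; lra. }
  assert (L1 : locally 0 (fun h => forall i, (i <= N)%nat -> forall j, (j <= N)%nat ->
    forall t, a <= t <= b -> Rabs (B i j (s + h) t - B i j s t) <= e1)).
  { apply (filter_forall_le (locally (0 : R))). intros i Hi.
    apply (filter_forall_le (locally (0 : R))). intros j Hj.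
    apply locally_0_uniform_continuity; auto.
    intros t Ht. apply (Ck_0 1 U); [apply HB | apply HD]; auto. }
  assert (L2 : locally 0 (fun h => forall i, (i <= N)%nat -> forall j, (j <= N)%nat ->
    forall t, a <= t <= b ->
    Rabs (B i j (s + h) t - B i j s t - h * dx (B i j) s t) <= e1 * Rabs h)).
  { apply (filter_forall_le (locally (0 : R))). intros i Hi.
    apply (filter_forall_le (locally (0 : R))). intros j Hj.
    apply (locally_0_uniform_derive U); [auto | intros x t; apply HD | auto]. }
  assert (L3 : locally 0 (fun h => forall i, (i <= N)%nat ->
    Rabs (base_sol c i (s + h) - base_sol c i s - h * z i t0) <= e1 * Rabs h)).
  { apply (filter_forall_le (locally (0 : R))). intros i Hi.
    assert (Hd := base_sol_derive c i s Hi). apply is_derive_Reals in Hd.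
    destruct (Hd e1 He1) as [d Hdd]. exists d. intros h Hh. simpl in h.
    assert (Hhd : Rabs h < d) by (apply ball_0_Rabs; exact Hh).
    assert (Hz : z i t0 = mulmv N (fun i j => A i j s t0) (fun j => base_sol c j s) i).
    { unfold z, mulmv. apply sum_eq. intros j Hj. unfold y. now rewrite frob_sol_t0. }
    rewrite Hz. set (l := mulmv _ _ _ _) in *.
    destruct (Req_dec h 0) as [-> | Hn].
    - rewrite Rplus_0_r, Rminus_diag, Rmult_0_l, Rminus_0_r, Rabs_R0. lra.
    - replace (base_sol c i (s + h) - base_sol c i s - h * l) with
        (((base_sol c i (s + h) - base_sol c i s) / h - l) * h) by (field; auto).
      rewrite Rabs_mult. apply Rmult_le_compat_r; [apply Rabs_pos |].
      left. apply Hdd; auto. }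
  generalize (filter_and _ _ L1 (filter_and _ _ L2 L3)).
  apply filter_imp. clear L1 L2 L3. intros h (L1 & L2 & L3) i t Hi Ht.
  simpl in h.
  assert (Hh := Rabs_pos h).
  (* With z = A y, the remainder r = y(s+h) - y(s) - h z satisfies r_t = B(s+h) r + g, where g =
     (B(s+h) - B(s) - h B_s) y + h (B(s+h) - B(s)) z. *)
  set (g := fun i t =>
    mulmv N (fun i j => B i j (s + h) t - B i j s t - h * dx (B i j) s t)
      (fun j => y j s t) i
    + h * mulmv N (fun i j => B i j (s + h) t - B i j s t) (fun j => z j t) i).
  apply Rle_trans with (C * (M * e1 * Rabs h)).
  2: { rewrite <- Rmult_assoc. apply Rmult_le_compat_r; lra. }
  revert i t Hi Ht.
  apply (HG (fun i j t => B i j (s + h) t) g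
           (fun i t => y i (s + h) t - y i s t - h * z i t)).
  - apply Rmult_le_pos; [nra | lra].
  - intros i t Hi Ht.
    assert (Hz : is_derive (z i) t
      (mulmv N (fun i j => dy (A i j) s t) (fun j => y j s t) i
       + mulmv N (fun i j => A i j s t)
           (mulmv N (fun i j => B i j s t) (fun j => y j s t)) i)).
    { apply (is_derive_mulmv N (fun i j t => A i j s t) (fun j t => y j s t)).
      - intros j Hj. apply Derive_correct. apply HA; auto. apply HD, Ht.
      - intros j Hj. apply frob_sol_dt; auto. }
    assert (Hd := frob_sol_dt c i (s + h) t Hi (HD t Ht)).
    assert (Hd' := frob_sol_dt c i s t Hi (HD t Ht)).
    (* Compatibility enters here: it turns A_t y + A B y, the [t]-derivative of z, into B_s y + B
       z. *)
    assert (Ez : mulmv N (fun i j => dy (A i j) s t) (fun j => y j s t) i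
       + mulmv N (fun i j => A i j s t)
           (mulmv N (fun i j => B i j s t) (fun j => y j s t)) i
       = mulmv N (fun i j => dx (B i j) s t) (fun j => y j s t) i
       + mulmv N (fun i j => B i j s t) (fun j => z j t) i).
    { unfold z. change (fun j => mulmv N (fun i j => A i j s t) (fun j => y j s t) j)
        with (mulmv N (fun i j => A i j s t) (fun j => y j s t)).
      rewrite !mulmv_assoc. unfold mulmv at 1 2 3 4. rewrite <- !plus_sum.
      apply sum_eq. intros j Hj. rewrite <- !Rmult_plus_distr_r.
      rewrite (Hcompat i j s t Hi Hj (HD t Ht)). reflexivity. }
    rewrite Ez in Hz.
    match type of Hz with is_derive _ _ ?l => set (lz := l) in * end.
    match goal with |- is_derive _ _ ?l => replace l with
      (mulmv N (fun i j => B i j (s + h) t) (fun j => y j (s + h) t) i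
       - mulmv N (fun i j => B i j s t) (fun j => y j s t) i - h * lz) end.
    + apply (is_derive_minus (V := R_NormedModule) (fun t => y i (s + h) t - y i s t)
               (fun t => h * z i t)).
      * apply (is_derive_minus (V := R_NormedModule)); assumption.
      * apply (is_derive_scal (fun t => z i t)). exact Hz.
    + unfold lz, g, mulmv. rewrite Rmult_plus_distr_l, !scal_sum.
      rewrite <- !plus_sum, <- !minus_sum. apply sum_eq. intros j Hj. ring.
  - intros i j t Hi Hj Ht.
    replace (B i j (s + h) t) with (B i j s t + (B i j (s + h) t - B i j s t)) by ring.
    eapply Rle_trans; [apply Rabs_triang |].
    apply Rplus_le_compat; [auto |]. apply Rle_trans with e1; auto.
  - intros i t Hi Ht. unfold g. eapply Rle_trans; [apply Rabs_triang |].
    rewrite Rabs_mult.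
    assert (Rabs (mulmv N (fun i j => B i j (s + h) t - B i j s t - h * dx (B i j) s t)
      (fun j => y j s t) i) <= INR (S N) * (e1 * Rabs h) * Y).
    { apply mulmv_bound; auto. }
    assert (Rabs (mulmv N (fun i j => B i j (s + h) t - B i j s t) (fun j => z j t) i)
      <= INR (S N) * e1 * Z).
    { apply mulmv_bound; auto. }
    assert (0 <= e1 * Rabs h) by nra.
    apply Rle_trans with (INR (S N) * (e1 * Rabs h) * Y + Rabs h * (INR (S N) * e1 * Z)).
    + apply Rplus_le_compat; [lra |]. apply Rmult_le_compat_l; lra.
    + unfold M. nra.
  - intros i Hi. unfold y. rewrite !frob_sol_t0.
    eapply Rle_trans; [apply (L3 i Hi) |].
    assert (0 <= e1 * Rabs h) by nra. nra.
Qed.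

Lemma frob_sol_ds (c : nat -> R) (i : nat) (s t : R) : (i <= N)%nat -> D t ->
  is_derive (fun s => frob_sol c i s t) s
    (mulmv N (fun i j => A i j s t) (fun j => frob_sol c j s t) i).
Proof.
  intros Hi Ht.
  destruct (open_convex_compact D t0 t) as (a & b & H1 & H2 & H3); auto.
  apply is_derive_Reals. intros e He.
  destruct (frob_sol_expansion c s a b (e / 2)) as [d Hd]; auto; try lra.
  exists d. intros h Hh Hhd.
  assert (HE : Rabs (frob_sol c i (s + h) t - frob_sol c i s t
          - h * mulmv N (fun i j => A i j s t) (fun j => frob_sol c j s t) i)
    <= e / 2 * Rabs h).
  { apply Hd; auto; [| lra]. now apply ball_0_Rabs. }
  set (l := mulmv _ _ _ _) in *.
  replace ((frob_sol c i (s + h) t - frob_sol c i s t) / h - l) with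
    ((frob_sol c i (s + h) t - frob_sol c i s t - h * l) / h) by (field; auto).
  unfold Rdiv. rewrite Rabs_mult, Rabs_inv.
  assert (Hp := Rabs_pos_lt h Hh).
  apply Rle_lt_trans with (e / 2 * Rabs h * / Rabs h).
  - apply Rmult_le_compat_r; [| exact HE]. left. now apply Rinv_0_lt_compat.
  - replace (e / 2 * Rabs h * / Rabs h) with (e / 2) by (field; lra). lra.
Qed.

Lemma frob_sol_integral (c : nat -> R) : integral_surface (frob_sol c).
Proof. intros i s t Hi Ht; split; [apply frob_sol_ds | apply frob_sol_dt]; auto. Qed.

Lemma frob_sol_init (c : nat -> R) (i : nat) : frob_sol c i 0 t0 = c i.
Proof. rewrite frob_sol_t0. apply (lin_sol_init N _ c 0). Qed.

(** Two partial derivatives alone do not give joint continuity. The expansion in [s], uniform in [t]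
    near the point, combined with continuity in [t] at fixed [s], does. *)
Lemma frob_sol_continuous (c : nat -> R) (i : nat) : (i <= N)%nat ->
  Ck 0 U (frob_sol c i).
Proof.
  intros Hi s t Ht. apply continuity_2d_pt_filterlim. intros eps.
  pose proof (cond_pos eps) as Heps.
  destruct (open_convex_compact D t0 t) as (a & b & H1 & H2 & H3); auto.
  destruct (vec_bound (fun i t => mulmv N (fun i j => A i j s t)
    (fun j => frob_sol c j s t) i) a b) as (Z & HZ & HZb).
  { intros j x Hj Hx. apply continuous_mulmv; intros.
    - apply continuous_A_snd; auto.
    - apply (ex_derive_continuous (fun t => frob_sol c j0 s t)).
      eexists. apply frob_sol_dt; auto. }
  destruct (frob_sol_expansion c s a b 1) as [d Hd]; auto; try lra.
  assert (Hct : continuous (fun t => frob_sol c i s t) t).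
  { apply (ex_derive_continuous (fun t => frob_sol c i s t)).
    eexists. apply frob_sol_dt; auto. }
  assert (He2 : 0 < eps / 2) by lra.
  destruct (proj1 (filterlim_locally _ _) Hct (mkposreal _ He2)) as [d2 Hd2].
  set (d3 := eps / (2 * (Z + 1))).
  assert (Hd3 : 0 < d3) by (apply Rdiv_lt_0_compat; lra).
  assert (Hdel : 0 < Rmin (Rmin d d2) (Rmin d3 (Rmin (t - a) (b - t)))).
  { repeat apply Rmin_pos; try apply cond_pos; lra. }
  exists (mkposreal _ Hdel). simpl. intros s' t' Hs' Ht'.
  apply Rmin_Rgt_l in Hs' as [Hs1 Hs2]. apply Rmin_Rgt_l in Hs1 as [Hs1 _].
  apply Rmin_Rgt_l in Hs2 as [Hs2 _].
  apply Rmin_Rgt_l in Ht' as [Ht1 Ht2]. apply Rmin_Rgt_l in Ht1 as [_ Ht1].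
  apply Rmin_Rgt_l in Ht2 as [_ Ht2]. apply Rmin_Rgt_l in Ht2 as [Ht2 Ht3].
  set (h := s' - s) in *.
  assert (Ht'ab : a <= t' <= b).
  { apply Rgt_lt, Rabs_lt_between' in Ht2, Ht3. lra. }
  replace (frob_sol c i s' t' - frob_sol c i s t) with
    ((frob_sol c i (s + h) t' - frob_sol c i s t'
      - h * mulmv N (fun i j => A i j s t') (fun j => frob_sol c j s t') i)
     + h * mulmv N (fun i j => A i j s t') (fun j => frob_sol c j s t') i
     + (frob_sol c i s t' - frob_sol c i s t)).
  2: { replace (s + h) with s' by (unfold h; ring). ring. }
  assert (E1 := Hd h).
  assert (E2 : Rabs (frob_sol c i s t' - frob_sol c i s t) < eps / 2).
  { apply (Hd2 t'). assumption. }
  specialize (E1 ltac:(now apply ball_0_Rabs) i t' Hi Ht'ab).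
  assert (E3 := HZb i Hi t' Ht'ab).
  set (l := mulmv _ _ _ _) in *.
  eapply Rle_lt_trans; [apply Rabs_triang |].
  apply Rle_lt_trans with (Rabs h * (Z + 1) + Rabs (frob_sol c i s t' - frob_sol c i s t)).
  - apply Rplus_le_compat_r. eapply Rle_trans; [apply Rabs_triang |].
    rewrite (Rabs_mult h). pose proof (Rabs_pos h). nra.
  - assert (Rabs h * (Z + 1) < eps / 2); [| lra].
    apply Rlt_le_trans with (d3 * (Z + 1)).
    + apply Rmult_lt_compat_r; [lra | assumption].
    + right. unfold d3. field. lra.
Qed.

(** Uniqueness for ordinary equations is applied along [t = t0], and then along each vertical
    line. *)
Lemma integral_surface_unique (y z : nat -> R -> R -> R) :
  integral_surface y -> integral_surface z ->
  (forall i, (i <= N)%nat -> y i 0 t0 = z i 0 t0) ->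
  forall i s t, (i <= N)%nat -> D t -> y i s t = z i s t.
Proof.
  intros Hy Hz H0.
  assert (Hb : forall i s, (i <= N)%nat -> y i s t0 - z i s t0 = 0).
  { intros i s Hi.
    apply (lin_ode_unique N (fun i j s => A i j s t0) (fun i s => y i s t0 - z i s t0)
             0 (fun _ => True)); auto.
    - apply open_true.
    - intros x u w; auto.
    - intros; apply continuous_A_fst; auto.
    - intros j x Hj _. rewrite mulmv_minus.
      apply (is_derive_minus (V := R_NormedModule)); [apply Hy | apply Hz]; auto.
    - intros j Hj. rewrite H0 by auto. ring. }
  intros i s t Hi Ht. apply Rminus_diag_uniq.
  apply (lin_ode_unique N (fun i j t => B i j s t) (fun i t => y i s t - z i s t)
           t0 D); auto.
  - intros; apply continuous_B_snd; auto.
  - intros j x Hj Hx. rewrite mulmv_minus.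
    apply (is_derive_minus (V := R_NormedModule)); [apply Hy | apply Hz]; auto.
Qed.

End Frobenius.

(** * Calculus of [Ck] functions *)

Definition open2 (U : R -> R -> Prop) : Prop :=
  open (fun p : R * R => U (fst p) (snd p)).

Lemma open2_fst (U : R -> R -> Prop) (x y : R) :
  open2 U -> U x y -> locally x (fun x' => U x' y).
Proof.
  intros HU Hxy. destruct (HU (x, y) Hxy) as [d Hd]. exists d.
  intros x' Hx'. apply (Hd (x', y)). split; [exact Hx' | apply ball_center].
Qed.

Lemma open2_snd (U : R -> R -> Prop) (x y : R) :
  open2 U -> U x y -> locally y (fun y' => U x y').
Proof.
  intros HU Hxy. destruct (HU (x, y) Hxy) as [d Hd]. exists d.
  intros y' Hy'. apply (Hd (x, y')). split; [apply ball_center | exact Hy'].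
Qed.

Lemma Ck_S_dx (k : nat) (U : R -> R -> Prop) (f : R -> R -> R) :
  Ck (S k) U f -> Ck k U (dx f).
Proof. intros H; exact (proj1 (proj2 (proj2 H))). Qed.

Lemma Ck_S_dy (k : nat) (U : R -> R -> Prop) (f : R -> R -> R) :
  Ck (S k) U f -> Ck k U (dy f).
Proof. intros H; exact (proj2 (proj2 (proj2 H))). Qed.

Section CkCalculus.

Variable (U : R -> R -> Prop).
Hypothesis (HU : open2 U).

Lemma dx_ext (f g : R -> R -> R) : (forall x y, U x y -> f x y = g x y) ->
  forall x y, U x y -> dx f x y = dx g x y.
Proof.
  intros H x y Hxy. apply Derive_ext_loc.
  apply (filter_imp (fun x' => U x' y)); [auto | now apply open2_fst].
Qed.

Lemma dy_ext (f g : R -> R -> R) : (forall x y, U x y -> f x y = g x y) ->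
  forall x y, U x y -> dy f x y = dy g x y.
Proof.
  intros H x y Hxy. apply Derive_ext_loc.
  apply (filter_imp (fun y' => U x y')); [auto | now apply open2_snd].
Qed.

Lemma Ck_ext (k : nat) (f g : R -> R -> R) :
  (forall x y, U x y -> f x y = g x y) -> Ck k U f -> Ck k U g.
Proof.
  revert f g. induction k as [|k IH]; intros f g H.
  - intros Hf x y Hxy.
    apply (continuous_ext_loc _ (fun p : R * R => f (fst p) (snd p))).
    + apply (filter_imp (fun p : R * R => U (fst p) (snd p))).
      * intros p Hp. auto.
      * now apply HU.
    + auto.
  - intros (Hd & H0 & H1 & H2). split; [| split; [| split]].
    + intros x y Hxy. destruct (Hd x y Hxy) as [Hx Hy]. split.
      * revert Hx. apply ex_derive_ext_loc.
        apply (filter_imp (fun x' => U x' y)); [auto | now apply open2_fst].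
      * revert Hy. apply ex_derive_ext_loc.
        apply (filter_imp (fun y' => U x y')); [auto | now apply open2_snd].
    + now apply (IH f).
    + apply (IH (dx f)); auto. now apply dx_ext.
    + apply (IH (dy f)); auto. now apply dy_ext.
Qed.

(** Lets explicit formulas stand for [dx f] and [dy f], so that the closure properties follow by
    induction on [k] from the usual differentiation rules. *)
Lemma Ck_S_intro (k : nat) (f fx fy : R -> R -> R) :
  (forall x y, U x y -> is_derive (fun t => f t y) x (fx x y)) ->
  (forall x y, U x y -> is_derive (fun t => f x t) y (fy x y)) ->
  Ck k U f -> Ck k U fx -> Ck k U fy -> Ck (S k) U f.
Proof.
  intros Hx Hy H0 H1 H2. split; [| split; [| split]].
  - intros x y Hxy. split; eexists; [apply Hx | apply Hy]; auto.
  - exact H0.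
  - apply (Ck_ext k fx); auto. intros x y Hxy. symmetry.
    now apply is_derive_unique, Hx.
  - apply (Ck_ext k fy); auto. intros x y Hxy. symmetry.
    now apply is_derive_unique, Hy.
Qed.

Lemma Ck_dx (k : nat) (f : R -> R -> R) (x y : R) : Ck (S k) U f -> U x y ->
  is_derive (fun t => f t y) x (dx f x y).
Proof. intros [H _] Hxy. exact (Derive_correct _ _ (proj1 (H x y Hxy))). Qed.

Lemma Ck_dy (k : nat) (f : R -> R -> R) (x y : R) : Ck (S k) U f -> U x y ->
  is_derive (fun t => f x t) y (dy f x y).
Proof. intros [H _] Hxy. exact (Derive_correct _ _ (proj2 (H x y Hxy))). Qed.

Lemma Ck_const (k : nat) (c : R) : Ck k U (fun _ _ => c).
Proof.
  revert c. induction k as [|k IH]; intros c.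
  - intros x y _. apply continuous_const.
  - apply (Ck_S_intro k _ (fun _ _ => 0) (fun _ _ => 0)); auto;
      intros; apply (is_derive_const (V := R_NormedModule)).
Qed.

Lemma Ck_plus (k : nat) (f g : R -> R -> R) :
  Ck k U f -> Ck k U g -> Ck k U (fun x y => f x y + g x y).
Proof.
  revert f g. induction k as [|k IH]; intros f g Hf Hg.
  - intros x y Hxy.
    apply (continuous_plus (V := R_NormedModule)
      (fun p : R * R => f (fst p) (snd p)) (fun p => g (fst p) (snd p))); auto.
  - apply (Ck_S_intro k _ (fun x y => dx f x y + dx g x y) (fun x y => dy f x y + dy g x y)).
    + intros x y Hxy. apply (is_derive_plus (V := R_NormedModule)); eapply Ck_dx; eauto.
    + intros x y Hxy. apply (is_derive_plus (V := R_NormedModule)); eapply Ck_dy; eauto.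
    + apply IH; now apply Ck_S_down.
    + apply IH; now apply Ck_S_dx.
    + apply IH; now apply Ck_S_dy.
Qed.

Lemma Ck_mult (k : nat) (f g : R -> R -> R) :
  Ck k U f -> Ck k U g -> Ck k U (fun x y => f x y * g x y).
Proof.
  revert f g. induction k as [|k IH]; intros f g Hf Hg.
  - intros x y Hxy.
    apply (continuous_mult (K := R_AbsRing)
      (fun p : R * R => f (fst p) (snd p)) (fun p => g (fst p) (snd p))); auto.
  - apply (Ck_S_intro k _ (fun x y => dx f x y * g x y + f x y * dx g x y)
             (fun x y => dy f x y * g x y + f x y * dy g x y)).
    + intros x y Hxy.
      apply (is_derive_mult (K := R_AbsRing) (fun x => f x y) (fun x => g x y)).
      * eapply Ck_dx; eauto.
      * eapply Ck_dx; eauto.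
      * intros; apply Rmult_comm.
    + intros x y Hxy.
      apply (is_derive_mult (K := R_AbsRing) (fun y => f x y) (fun y => g x y)).
      * eapply Ck_dy; eauto.
      * eapply Ck_dy; eauto.
      * intros; apply Rmult_comm.
    + apply IH; now apply Ck_S_down.
    + apply Ck_plus; apply IH; auto using Ck_S_down, Ck_S_dx.
    + apply Ck_plus; apply IH; auto using Ck_S_down, Ck_S_dy.
Qed.

Lemma Ck_scal (k : nat) (c : R) (f : R -> R -> R) :
  Ck k U f -> Ck k U (fun x y => c * f x y).
Proof. intros Hf. apply Ck_mult; [apply Ck_const | exact Hf]. Qed.

Lemma Ck_opp (k : nat) (f : R -> R -> R) :
  Ck k U f -> Ck k U (fun x y => - f x y).
Proof.
  intros Hf. apply (Ck_ext k (fun x y => -1 * f x y)); [intros; ring |].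
  now apply Ck_scal.
Qed.

Lemma Ck_exp (k : nat) (f : R -> R -> R) :
  Ck k U f -> Ck k U (fun x y => exp (f x y)).
Proof.
  revert f. induction k as [|k IH]; intros f Hf.
  - intros x y Hxy.
    apply (continuous_comp (fun p : R * R => f (fst p) (snd p)) exp); [auto |].
    apply (ex_derive_continuous exp). eexists. apply is_derive_exp.
  - apply (Ck_S_intro k _ (fun x y => dx f x y * exp (f x y))
             (fun x y => dy f x y * exp (f x y))).
    + intros x y Hxy. apply (is_derive_comp exp (fun x => f x y)).
      * apply is_derive_exp.
      * eapply Ck_dx; eauto.
    + intros x y Hxy. apply (is_derive_comp exp (fun y => f x y)).
      * apply is_derive_exp.
      * eapply Ck_dy; eauto.
    + apply IH, Ck_S_down, Hf.
    + apply Ck_mult; [apply Ck_S_dx, Hf | apply IH, Ck_S_down, Hf].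
    + apply Ck_mult; [apply Ck_S_dy, Hf | apply IH, Ck_S_down, Hf].
Qed.

Lemma Ck_sum_f_R0 (k : nat) (f : nat -> R -> R -> R) (N : nat) :
  (forall j, (j <= N)%nat -> Ck k U (f j)) ->
  Ck k U (fun x y => sum_f_R0 (fun j => f j x y) N).
Proof.
  induction N as [|N IH]; intros H; simpl; [apply H; lia |].
  apply Ck_plus; [apply IH; intros |]; apply H; lia.
Qed.

Lemma Ck_snd (k : nat) : Ck k U (fun _ y => y).
Proof.
  induction k as [|k IH].
  - intros x y _. apply continuous_snd.
  - apply (Ck_S_intro k _ (fun _ _ => 0) (fun _ _ => 1)); auto using Ck_const.
    + intros; apply (is_derive_const (V := R_NormedModule)).
    + intros; apply (is_derive_id (K := R_AbsRing)).
Qed.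

(** The two claims share one induction because each function is, up to sign, the derivative of the
    other. *)
Lemma Ck_cos_sin (k : nat) :
  Ck k U (fun x _ => cos x) /\ Ck k U (fun x _ => sin x).
Proof.
  induction k as [|k [IHc IHs]].
  - split; intros x y _.
    + apply (continuous_comp (fun p : R * R => fst p) cos); [apply continuous_fst |].
      apply continuous_cos.
    + apply (continuous_comp (fun p : R * R => fst p) sin); [apply continuous_fst |].
      apply continuous_sin.
  - split.
    + apply (Ck_S_intro k _ (fun x _ => - sin x) (fun _ _ => 0)); auto using Ck_const, Ck_opp.
      * intros. apply is_derive_cos.
      * intros; apply (is_derive_const (V := R_NormedModule)).
    + apply (Ck_S_intro k _ (fun x _ => cos x) (fun _ _ => 0)); auto using Ck_const.
      * intros. apply is_derive_sin.
      * intros; apply (is_derive_const (V := R_NormedModule)).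
Qed.

End CkCalculus.

(** * Chain rule, composition and smoothness of integral surfaces *)

(** The chain rule requires total differentiability of [f], which follows since [dx f] exists near
    the point and is continuous there, and [dy f] exists at the point. *)
Lemma chain_rule_2 (V : R -> R -> Prop) (f : R -> R -> R) (g h : R -> R) (x g' h' : R) :
  open2 V -> Ck 1 V f -> V (g x) (h x) -> is_derive g x g' -> is_derive h x h' ->
  is_derive (fun x => f (g x) (h x)) x
    (dx f (g x) (h x) * g' + dy f (g x) (h x) * h').
Proof.
  intros HV Hf Hx Hg Hh.
  apply (filterdiff_ext_lin _ (fun y : R => plus (scal (scal y g') (dx f (g x) (h x)))
    (scal (scal y h') (dy f (g x) (h x))))).
  - apply (filterdiff_comp'_2 g h f x (fun y => scal y g') (fun y => scal y h')
      (fun p q => plus (scal p (dx f (g x) (h x))) (scal q (dy f (g x) (h x)))));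
      [exact Hg | exact Hh |].
    apply (is_derive_filterdiff f (g x) (h x) (dx f)).
    + apply (filter_imp (fun p : R * R => V (fst p) (snd p))); [| now apply HV].
      intros p Hp. eapply Ck_dx; eauto.
    + eapply Ck_dy; eauto.
    + now apply (Ck_S_dx 0 V f Hf).
  - intros y. unfold plus, scal; simpl. unfold mult; simpl. ring.
Qed.

Lemma Ck_comp (U V : R -> R -> Prop) (g h : R -> R -> R) (k : nat) (f : R -> R -> R) :
  open2 U -> open2 V -> (forall x y, U x y -> V (g x y) (h x y)) ->
  smooth_on U g -> smooth_on U h -> Ck k V f ->
  Ck k U (fun x y => f (g x y) (h x y)).
Proof.
  intros HU HV Hmap Hg Hh. revert f. induction k as [|k IH]; intros f Hf.
  - intros x y Hxy.
    apply (continuous_comp_2 (fun p : R * R => g (fst p) (snd p))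
             (fun p : R * R => h (fst p) (snd p)) f).
    + now apply (Hg 0%nat).
    + now apply (Hh 0%nat).
    + apply Hf. simpl. auto.
  - assert (Hf1 : Ck 1 V f).
    { split; [exact (proj1 Hf) | split; [| split]]; apply (Ck_0 k).
      - apply Ck_S_down, Hf.
      - apply Ck_S_dx, Hf.
      - apply Ck_S_dy, Hf. }
    apply (Ck_S_intro U HU k _
      (fun x y => dx f (g x y) (h x y) * dx g x y + dy f (g x y) (h x y) * dx h x y)
      (fun x y => dx f (g x y) (h x y) * dy g x y + dy f (g x y) (h x y) * dy h x y)).
    + intros x y Hxy. apply (chain_rule_2 V f (fun x => g x y) (fun x => h x y)); auto.
      * exact (Ck_dx U 0 g x y (Hg 1%nat) Hxy).
      * exact (Ck_dx U 0 h x y (Hh 1%nat) Hxy).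
    + intros x y Hxy. apply (chain_rule_2 V f (fun y => g x y) (fun y => h x y)); auto.
      * exact (Ck_dy U 0 g x y (Hg 1%nat) Hxy).
      * exact (Ck_dy U 0 h x y (Hh 1%nat) Hxy).
    + apply IH, Ck_S_down, Hf.
    + apply Ck_plus; auto; apply Ck_mult; auto.
      * apply IH, Ck_S_dx, Hf.
      * apply Ck_S_dx, (Hg (S k)).
      * apply IH, Ck_S_dy, Hf.
      * apply Ck_S_dx, (Hh (S k)).
    + apply Ck_plus; auto; apply Ck_mult; auto.
      * apply IH, Ck_S_dx, Hf.
      * apply Ck_S_dy, (Hg (S k)).
      * apply IH, Ck_S_dy, Hf.
      * apply Ck_S_dy, (Hh (S k)).
Qed.

(** Bootstrap: the first derivatives of [y] are [A y] and [B y], hence as regular as [y] itself, and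
    joint continuity starts the induction. *)
Lemma integral_surface_smooth (N : nat) (A B : nat -> nat -> R -> R -> R) (D : R -> Prop)
  (y : nat -> R -> R -> R) :
  open2 (fun _ t => D t) ->
  (forall i j, (i <= N)%nat -> (j <= N)%nat -> smooth_on (fun _ t => D t) (A i j)) ->
  (forall i j, (i <= N)%nat -> (j <= N)%nat -> smooth_on (fun _ t => D t) (B i j)) ->
  integral_surface N A B D y ->
  (forall i, (i <= N)%nat -> Ck 0 (fun _ t => D t) (y i)) ->
  forall i, (i <= N)%nat -> smooth_on (fun _ t => D t) (y i).
Proof.
  intros HU HA HB Hy H0 i Hi k. revert i Hi. induction k as [|k IH]; [exact H0 |].
  intros i Hi.
  apply (Ck_S_intro _ HU k _
    (fun s t => mulmv N (fun i j => A i j s t) (fun j => y j s t) i)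
    (fun s t => mulmv N (fun i j => B i j s t) (fun j => y j s t) i)).
  - intros s t Ht. now apply Hy.
  - intros s t Ht. now apply Hy.
  - auto.
  - apply (Ck_sum_f_R0 _ HU k (fun j s t => A i j s t * y j s t)).
    intros j Hj. apply Ck_mult; auto. now apply HA.
  - apply (Ck_sum_f_R0 _ HU k (fun j s t => B i j s t * y j s t)).
    intros j Hj. apply Ck_mult; auto. now apply HB.
Qed.

(** * Orthonormal frames *)

Lemma vec3_ext (u w : vec3) : c1 u = c1 w -> c2 u = c2 w -> c3 u = c3 w -> u = w.
Proof. destruct u, w; simpl; intros -> -> ->; reflexivity. Qed.

Lemma vec3_eq_of_dot (d : vec3) : dot d d = 0 -> d = V3 0 0 0.
Proof. intros H. unfold dot in H. apply vec3_ext; simpl; nra. Qed.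

Definition orthonormal_frame (u w n : vec3) : Prop :=
  dot u u = 1 /\ dot w w = 1 /\ dot n n = 1 /\
  dot u w = 0 /\ dot u n = 0 /\ dot w n = 0 /\ cross u w = n.

Lemma orthonormal_frame_complete (u w n d : vec3) :
  orthonormal_frame u w n -> dot u d = 0 -> dot w d = 0 -> dot n d = 0 -> d = V3 0 0 0.
Proof.
  intros (Hu & Hw & Hn & Huw & Hun & Hwn & Hc) H1 H2 H3.
  assert (Hdet : dot (cross u w) n = 1) by (rewrite Hc; exact Hn).
  (* Cramer's rule: the determinant of the frame times [d] is expressed through the three inner
     products of [d] with the frame. *)
  assert (E : vscale (dot (cross u w) n) d =
    vadd (vadd (vscale (dot u d) (cross w n)) (vscale (dot w d) (cross n u)))
      (vscale (dot n d) (cross u w))).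
  { apply vec3_ext; unfold dot, cross, vscale, vadd; simpl; ring. }
  rewrite Hdet, H1, H2, H3 in E.
  apply vec3_ext; [apply (f_equal c1) in E | apply (f_equal c2) in E
    | apply (f_equal c3) in E]; simpl in E |- *; lra.
Qed.

Definition frame_motion (u w n b x : vec3) : vec3 :=
  vadd (vadd (vadd (vscale (c1 x) u) (vscale (c2 x) w)) (vscale (c3 x) n)) b.

Definition frame_motion_inv (u w n b p : vec3) : vec3 :=
  V3 (dot u (vsub p b)) (dot w (vsub p b)) (dot n (vsub p b)).

Lemma frame_motion_rigid (u w n b : vec3) :
  orthonormal_frame u w n -> rigid_motion (frame_motion u w n b).
Proof.
  intros (Hu & Hw & Hn & Huw & Hun & Hwn & Hc).
  exists u, w, n, b. repeat split; assumption.
Qed.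

Lemma frame_motion_invK (u w n b p : vec3) : orthonormal_frame u w n ->
  frame_motion_inv u w n b (frame_motion u w n b p) = p.
Proof.
  intros (Hu & Hw & Hn & Huw & Hun & Hwn & Hc).
  assert (E : forall q, dot q (vsub (frame_motion u w n b p) b)
    = c1 p * dot u q + c2 p * dot w q + c3 p * dot n q).
  { intros q. unfold frame_motion, dot, vsub, vadd, vscale; simpl; ring. }
  assert (Hs : forall q r, dot q r = dot r q) by (intros; unfold dot; ring).
  apply vec3_ext; simpl; rewrite E.
  - rewrite Hu, (Hs w u), (Hs n u), Huw, Hun; ring.
  - rewrite Huw, Hw, (Hs n w), Hwn; ring.
  - rewrite Hun, Hwn, Hn; ring.
Qed.

(** The right inverse follows from the left one: [p] and its image [p'] under the composition have
    the same inverse image, so [vsub p' p] is orthogonal to the whole frame and vanishes. *)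
Lemma frame_motionK (u w n b p : vec3) : orthonormal_frame u w n ->
  frame_motion u w n b (frame_motion_inv u w n b p) = p.
Proof.
  intros Hf. set (q := frame_motion_inv u w n b p).
  assert (Hq := frame_motion_invK u w n b q Hf).
  set (p' := frame_motion u w n b q) in *. clearbody p'.
  assert (E : vsub p' p = V3 0 0 0).
  { assert (L : forall r, dot r (vsub p' p) = dot r (vsub p' b) - dot r (vsub p b)).
    { intros r. unfold dot, vsub; simpl; ring. }
    apply (orthonormal_frame_complete u w n); auto; rewrite L.
    - apply (f_equal c1) in Hq.
      change (dot u (vsub p' b) = dot u (vsub p b)) in Hq. lra.
    - apply (f_equal c2) in Hq.
      change (dot w (vsub p' b) = dot w (vsub p b)) in Hq. lra.
    - apply (f_equal c3) in Hq.
      change (dot n (vsub p' b) = dot n (vsub p b)) in Hq. lra. }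
  apply vec3_ext; [apply (f_equal c1) in E | apply (f_equal c2) in E
    | apply (f_equal c3) in E]; simpl in E; lra.
Qed.

(** * Derivatives of vector-valued functions and evolution of frames *)

Definition is_vderive (u : R -> vec3) (x : R) (l : vec3) : Prop :=
  is_derive (fun x => c1 (u x)) x (c1 l) /\
  is_derive (fun x => c2 (u x)) x (c2 l) /\
  is_derive (fun x => c3 (u x)) x (c3 l).

Lemma is_derive_Rmult (f g : R -> R) (x f' g' : R) :
  is_derive f x f' -> is_derive g x g' ->
  is_derive (fun x => f x * g x) x (f' * g x + f x * g').
Proof.
  intros Hf Hg. apply (is_derive_mult (K := R_AbsRing) f g); auto.
  intros; apply Rmult_comm.
Qed.

Lemma is_derive_Rconst (c x : R) : is_derive (fun _ : R => c) x 0.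
Proof. apply (is_derive_const (V := R_NormedModule)). Qed.

Lemma is_derive_Ropp (f : R -> R) (x f' : R) :
  is_derive f x f' -> is_derive (fun x => - f x) x (- f').
Proof. intros Hf. now apply (is_derive_opp (V := R_NormedModule)). Qed.

Lemma is_derive_Rplus (f g : R -> R) (x f' g' : R) :
  is_derive f x f' -> is_derive g x g' ->
  is_derive (fun x => f x + g x) x (f' + g').
Proof. intros Hf Hg. now apply (is_derive_plus (V := R_NormedModule)). Qed.

(** Reads a derivative off the shape of the function; [is_derive_value] then reduces the goal to an
    algebraic identity between the value found and the one expected. *)
Ltac derive_poly :=
  match goal with
  | |- is_derive (fun x => @?f x + @?g x) _ _ => apply (is_derive_Rplus f g)
  | |- is_derive (fun x => @?f x * @?g x) _ _ => apply (is_derive_Rmult f g)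
  | |- is_derive (fun x => - @?f x) _ _ => apply (is_derive_Ropp f)
  | |- is_derive (fun _ => ?c) _ _ => apply (is_derive_Rconst c)
  end.

Lemma is_derive_value (f : R -> R) (x l l' : R) :
  is_derive f x l -> l = l' -> is_derive f x l'.
Proof. now intros H <-. Qed.

Lemma is_derive_dot (u w : R -> vec3) (x : R) (u' w' : vec3) :
  is_vderive u x u' -> is_vderive w x w' ->
  is_derive (fun x => dot (u x) (w x)) x (dot u' (w x) + dot (u x) w').
Proof.
  intros (H1 & H2 & H3) (K1 & K2 & K3).
  eapply is_derive_value.
  - unfold dot. repeat derive_poly; eassumption.
  - unfold dot. ring.
Qed.

Lemma is_vderive_cross (u w : R -> vec3) (x : R) (u' w' : vec3) :
  is_vderive u x u' -> is_vderive w x w' ->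
  is_vderive (fun x => cross (u x) (w x)) x (vadd (cross u' (w x)) (cross (u x) w')).
Proof.
  intros (H1 & H2 & H3) (K1 & K2 & K3). unfold is_vderive, cross; simpl.
  unfold Rminus.
  split; [| split]; (eapply is_derive_value; [repeat derive_poly; eassumption | ring]).
Qed.

Lemma constant_of_derive_0 (D : R -> Prop) (f : R -> R) (x0 x : R) :
  convex D -> D x0 -> D x -> (forall y, D y -> is_derive f y 0) -> f x = f x0.
Proof.
  intros Hc H0 Hx Hd.
  destruct (MVT_gen f x0 x (fun _ => 0)) as (c & _ & E).
  - intros y Hy. apply Hd. apply (convex_minmax D x0 x); auto; lra.
  - intros y Hy. apply continuity_pt_filterlim, (ex_derive_continuous f).
    exists 0. apply Hd. now apply (convex_minmax D x0 x).
  - lra.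
Qed.

Lemma sum_sqr_6_eq_0 (a b c d e f : R) :
  a * a + b * b + c * c + 2 * (d * d) + 2 * (e * e) + 2 * (f * f) = 0 ->
  a = 0 /\ b = 0 /\ c = 0 /\ d = 0 /\ e = 0 /\ f = 0.
Proof.
  intros H. pose proof (Rle_0_sqr a). pose proof (Rle_0_sqr b).
  pose proof (Rle_0_sqr c). pose proof (Rle_0_sqr d).
  pose proof (Rle_0_sqr e). pose proof (Rle_0_sqr f).
  unfold Rsqr in *. repeat split; apply Rsqr_0_uniq; unfold Rsqr; lra.
Qed.

(* With G the Gram matrix of the frame, tr ((G - I)^2) and det are first integrals of the
   skew-symmetric system. *)
Lemma orthonormal_frame_propagates (D : R -> Prop) (u w n : R -> vec3) (al be ga : R -> R)
  (x0 x : R) :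
  convex D -> D x0 -> D x ->
  (forall x, D x -> is_vderive u x (vadd (vscale (al x) (w x)) (vscale (be x) (n x)))) ->
  (forall x, D x -> is_vderive w x (vadd (vscale (- al x) (u x)) (vscale (ga x) (n x)))) ->
  (forall x, D x -> is_vderive n x (vadd (vscale (- be x) (u x)) (vscale (- ga x) (w x)))) ->
  orthonormal_frame (u x0) (w x0) (n x0) -> orthonormal_frame (u x) (w x) (n x).
Proof.
  intros Hc H0 Hx Hu Hw Hn (I1 & I2 & I3 & I4 & I5 & I6 & I7).
  (* Written with [+ -1] since [derive_poly] has no case for subtraction. *)
  set (E := fun x => (dot (u x) (u x) + -1) * (dot (u x) (u x) + -1)
    + (dot (w x) (w x) + -1) * (dot (w x) (w x) + -1)
    + (dot (n x) (n x) + -1) * (dot (n x) (n x) + -1)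
    + 2 * (dot (u x) (w x) * dot (u x) (w x)) + 2 * (dot (u x) (n x) * dot (u x) (n x))
    + 2 * (dot (w x) (n x) * dot (w x) (n x))).
  assert (HE : E x = E x0).
  { apply (constant_of_derive_0 D); auto. intros y Hy. unfold E.
    pose proof (Hu y Hy) as du. pose proof (Hw y Hy) as dw. pose proof (Hn y Hy) as dn.
    eapply is_derive_value.
    - repeat derive_poly; apply is_derive_dot; eassumption.
    - unfold dot, vadd, vscale; simpl. ring. }
  assert (Hdet : dot (cross (u x) (w x)) (n x) = dot (cross (u x0) (w x0)) (n x0)).
  { apply (constant_of_derive_0 D (fun x => dot (cross (u x) (w x)) (n x))); auto.
    intros y Hy.
    eapply is_derive_value.
    - apply (is_derive_dot (fun x => cross (u x) (w x))).
      + apply is_vderive_cross; [apply (Hu y Hy) | apply (Hw y Hy)].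
      + apply (Hn y Hy).
    - unfold dot, cross, vadd, vscale; simpl. ring. }
  rewrite I7, I3 in Hdet.
  assert (HE0 : E x0 = 0).
  { unfold E. rewrite I1, I2, I3, I4, I5, I6. ring. }
  rewrite HE0 in HE. unfold E in HE. clear HE0 E.
  destruct (sum_sqr_6_eq_0 _ _ _ _ _ _ HE) as (J1 & J2 & J3 & J4 & J5 & J6).
  assert (K : forall a, a + -1 = 0 -> a = 1) by (intros; lra).
  apply K in J1, J2, J3.
  (* By Lagrange's identity |u x w - n|^2 = |u|^2 |w|^2 - (u.w)^2 - 2 det + |n|^2, which is 1 - 0 -
     2 + 1 = 0. *)
  assert (J7 : vsub (cross (u x) (w x)) (n x) = V3 0 0 0).
  { apply vec3_eq_of_dot.
    replace (dot (vsub (cross (u x) (w x)) (n x)) (vsub (cross (u x) (w x)) (n x)))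
      with (dot (u x) (u x) * dot (w x) (w x) - dot (u x) (w x) * dot (u x) (w x)
            - 2 * dot (cross (u x) (w x)) (n x) + dot (n x) (n x))
      by (unfold dot, vsub, cross; simpl; ring).
    rewrite J1, J2, J3, J4, Hdet. ring. }
  repeat split; auto.
  apply vec3_ext; [apply (f_equal c1) in J7 | apply (f_equal c2) in J7
    | apply (f_equal c3) in J7]; simpl in J7 |- *; lra.
Qed.

(** * The minimal surface with conformal factor [exp w] and second fundamental form
    [C0 (ds^2 - dt^2)] *)

Section Surface.

Variables (w : R -> R -> R) (C0 : R) (D : R -> Prop).
Let U (s t : R) : Prop := D t.
Hypotheses (HDo : open D) (HDc : convex D) (HD0 : D 0) (Hw : smooth_on U w)
  (Hliouville : forall s t, D t ->
     dx (dx w) s t + dy (dy w) s t = C0 ^ 2 * exp (- (2 * w s t))).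

(* Rows 0, 1, 2 are one coordinate of X_s / |X_s|, X_t / |X_t| and of the normal;
   row 3 is the same coordinate of X. *)
Definition coefA (i j : nat) (s t : R) : R :=
  match i, j with
  | 0%nat, 1%nat => - dy w s t
  | 0%nat, 2%nat => C0 * exp (- w s t)
  | 1%nat, 0%nat => dy w s t
  | 2%nat, 0%nat => - (C0 * exp (- w s t))
  | 3%nat, 0%nat => exp (w s t)
  | _, _ => 0
  end.

(** The entries with [C0] have the sign opposite to those in [coefA]: the second fundamental form is
    traceless. *)
Definition coefB (i j : nat) (s t : R) : R :=
  match i, j with
  | 0%nat, 1%nat => dx w s t
  | 1%nat, 0%nat => - dx w s t
  | 1%nat, 2%nat => - (C0 * exp (- w s t))
  | 2%nat, 1%nat => C0 * exp (- w s t)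
  | 3%nat, 1%nat => exp (w s t)
  | _, _ => 0
  end.

Lemma open2_strip : open2 U.
Proof.
  intros [s t] Ht. destruct (HDo t Ht) as [d Hd]. exists d.
  intros [s' t'] [_ H]. now apply Hd.
Qed.

Lemma smooth_dx (f : R -> R -> R) : smooth_on U f -> smooth_on U (dx f).
Proof. intros H k. apply Ck_S_dx, H. Qed.

Lemma smooth_dy (f : R -> R -> R) : smooth_on U f -> smooth_on U (dy f).
Proof. intros H k. apply Ck_S_dy, H. Qed.

Lemma smooth_coefA (i j : nat) : smooth_on U (coefA i j).
Proof.
  intros k. pose proof open2_strip as HU.
  pose proof (smooth_dy w Hw k) as H1. pose proof (Hw k) as H2.
  assert (H3 : Ck k U (fun s t => C0 * exp (- w s t))).
  { apply Ck_scal, Ck_exp, Ck_opp; auto. }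
  destruct i as [|[|[|[|i]]]]; destruct j as [|[|[|j]]]; unfold coefA;
    first [exact H1 | exact H3 | apply Ck_const, HU | apply Ck_exp; assumption
          | apply Ck_opp; assumption].

Qed.

Lemma smooth_coefB (i j : nat) : smooth_on U (coefB i j).
Proof.
  intros k. pose proof open2_strip as HU.
  pose proof (smooth_dx w Hw k) as H1. pose proof (Hw k) as H2.
  assert (H3 : Ck k U (fun s t => C0 * exp (- w s t))).
  { apply Ck_scal, Ck_exp, Ck_opp; auto. }
  destruct i as [|[|[|[|i]]]]; destruct j as [|[|[|j]]]; unfold coefB;
    first [exact H1 | exact H3 | apply Ck_const, HU | apply Ck_exp; assumption
          | apply Ck_opp; assumption].

Qed.

Lemma is_derive_Rexp (f : R -> R) (x f' : R) :
  is_derive f x f' -> is_derive (fun x => exp (f x)) x (f' * exp (f x)).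
Proof. intros H. apply (is_derive_comp exp f); [apply is_derive_exp | exact H]. Qed.

Lemma w_ds (s t : R) : D t -> is_derive (fun s => w s t) s (dx w s t).
Proof. intros Ht. exact (Ck_dx U 0 w s t (Hw 1%nat) Ht). Qed.

Lemma w_dt (s t : R) : D t -> is_derive (fun t => w s t) t (dy w s t).
Proof. intros Ht. exact (Ck_dy U 0 w s t (Hw 1%nat) Ht). Qed.

Lemma coefA_dt (i j : nat) (s t : R) : D t ->
  dy (coefA i j) s t =
  match i, j with
  | 0%nat, 1%nat => - dy (dy w) s t
  | 0%nat, 2%nat => - (C0 * dy w s t * exp (- w s t))
  | 1%nat, 0%nat => dy (dy w) s t
  | 2%nat, 0%nat => C0 * dy w s t * exp (- w s t)
  | 3%nat, 0%nat => dy w s t * exp (w s t)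
  | _, _ => 0
  end.
Proof.
  intros Ht. pose proof (w_dt s t Ht) as H1.
  assert (H2 : is_derive (fun t => dy w s t) t (dy (dy w) s t)).
  { exact (Ck_dy U 0 (dy w) s t (smooth_dy w Hw 1%nat) Ht). }
  apply is_derive_unique.
  destruct i as [|[|[|[|i]]]]; destruct j as [|[|[|j]]]; simpl;
    try apply is_derive_Rconst; try exact H2.
  - apply is_derive_Ropp, H2.
  - eapply is_derive_value.
    + derive_poly; [derive_poly |].
      apply (is_derive_Rexp (fun t => - w s t)). derive_poly. exact H1.
    + simpl. ring.
  - eapply is_derive_value.
    + derive_poly. derive_poly; [derive_poly |].
      apply (is_derive_Rexp (fun t => - w s t)). derive_poly. exact H1.
    + simpl. ring.
  - apply (is_derive_Rexp (fun t => w s t)), H1.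
Qed.

Lemma coefB_ds (i j : nat) (s t : R) : D t ->
  dx (coefB i j) s t =
  match i, j with
  | 0%nat, 1%nat => dx (dx w) s t
  | 1%nat, 0%nat => - dx (dx w) s t
  | 1%nat, 2%nat => C0 * dx w s t * exp (- w s t)
  | 2%nat, 1%nat => - (C0 * dx w s t * exp (- w s t))
  | 3%nat, 1%nat => dx w s t * exp (w s t)
  | _, _ => 0
  end.
Proof.
  intros Ht. pose proof (w_ds s t Ht) as H1.
  assert (H2 : is_derive (fun s => dx w s t) s (dx (dx w) s t)).
  { exact (Ck_dx U 0 (dx w) s t (smooth_dx w Hw 1%nat) Ht). }
  apply is_derive_unique.
  destruct i as [|[|[|[|i]]]]; destruct j as [|[|[|j]]]; simpl;
    try apply is_derive_Rconst; try exact H2.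
  - apply is_derive_Ropp, H2.
  - eapply is_derive_value.
    + derive_poly. derive_poly; [derive_poly |].
      apply (is_derive_Rexp (fun s => - w s t)). derive_poly. exact H1.
    + simpl. ring.
  - eapply is_derive_value.
    + derive_poly; [derive_poly |].
      apply (is_derive_Rexp (fun s => - w s t)). derive_poly. exact H1.
    + simpl. ring.
  - apply (is_derive_Rexp (fun s => w s t)), H1.
Qed.

(* The only nontrivial entries are the Gauss equation (Liouville's equation for w);
   the Codazzi equations hold because the Hopf differential is constant. *)
Lemma coef_compat (i j : nat) (s t : R) : (i <= 3)%nat -> (j <= 3)%nat -> D t ->
  dy (coefA i j) s t
    + mulmm 3 (fun i j => coefA i j s t) (fun i j => coefB i j s t) i j
  = dx (coefB i j) s t
    + mulmm 3 (fun i j => coefB i j s t) (fun i j => coefA i j s t) i j.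
Proof.
  intros Hi Hj Ht. rewrite coefA_dt, coefB_ds by auto.
  assert (HL := Hliouville s t Ht).
  replace (exp (- (2 * w s t))) with (exp (- w s t) * exp (- w s t)) in HL.
  2: { rewrite <- exp_plus. f_equal. ring. }
  unfold mulmm.
  destruct i as [|[|[|[|i]]]]; [| | | | lia];
    (destruct j as [|[|[|[|j]]]]; [| | | | lia]); simpl; lra || nra.
Qed.

(** [a] numbers the coordinate of R^3 and [i] the row of the system. The initial values make the
    frame at the origin the standard basis and place the surface point there at 0. *)
Definition surf (a i : nat) (s t : R) : R :=
  frob_sol 3 coefA coefB 0 (fun k => if Nat.eqb a k then 1 else 0) i s t.

Lemma surf_integral (a : nat) : integral_surface 3 coefA coefB D (surf a).
Proof.
  apply frob_sol_integral; auto; intros.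
  - apply smooth_coefA.
  - apply smooth_coefB.
  - now apply coef_compat.
Qed.

Lemma surf_init (a i : nat) : surf a i 0 0 = if Nat.eqb a i then 1 else 0.
Proof. apply (frob_sol_init 3 coefA coefB 0 (fun k => if Nat.eqb a k then 1 else 0)). Qed.

Lemma surf_smooth (a i : nat) : (i <= 3)%nat -> smooth_on U (surf a i).
Proof.
  apply (integral_surface_smooth 3 coefA coefB D (surf a) open2_strip).
  - intros; apply smooth_coefA.
  - intros; apply smooth_coefB.
  - apply surf_integral.
  - intros k Hk. apply (frob_sol_continuous 3 coefA coefB D 0); auto; intros.
    + apply smooth_coefA.
    + apply smooth_coefB.
    + now apply coef_compat.
Qed.

Definition surfvec (i : nat) (s t : R) : vec3 :=
  V3 (surf 0 i s t) (surf 1 i s t) (surf 2 i s t).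

Lemma surf_ds0 (a : nat) (s t : R) : D t ->
  is_derive (fun s => surf a 0 s t) s
    (- dy w s t * surf a 1 s t + C0 * exp (- w s t) * surf a 2 s t).
Proof.
  intros Ht. eapply is_derive_value.
  - exact (proj1 (surf_integral a 0%nat s t ltac:(lia) Ht)).
  - unfold mulmv; simpl; ring.
Qed.

Lemma surf_ds1 (a : nat) (s t : R) : D t ->
  is_derive (fun s => surf a 1 s t) s (dy w s t * surf a 0 s t).
Proof.
  intros Ht. eapply is_derive_value.
  - exact (proj1 (surf_integral a 1%nat s t ltac:(lia) Ht)).
  - unfold mulmv; simpl; ring.
Qed.

Lemma surf_ds2 (a : nat) (s t : R) : D t ->
  is_derive (fun s => surf a 2 s t) s (- (C0 * exp (- w s t)) * surf a 0 s t).
Proof.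
  intros Ht. eapply is_derive_value.
  - exact (proj1 (surf_integral a 2%nat s t ltac:(lia) Ht)).
  - unfold mulmv; simpl; ring.
Qed.

Lemma surf_ds3 (a : nat) (s t : R) : D t ->
  is_derive (fun s => surf a 3 s t) s (exp (w s t) * surf a 0 s t).
Proof.
  intros Ht. eapply is_derive_value.
  - exact (proj1 (surf_integral a 3%nat s t ltac:(lia) Ht)).
  - unfold mulmv; simpl; ring.
Qed.

Lemma surf_dt0 (a : nat) (s t : R) : D t ->
  is_derive (fun t => surf a 0 s t) t (dx w s t * surf a 1 s t).
Proof.
  intros Ht. eapply is_derive_value.
  - exact (proj2 (surf_integral a 0%nat s t ltac:(lia) Ht)).
  - unfold mulmv; simpl; ring.
Qed.

Lemma surf_dt1 (a : nat) (s t : R) : D t ->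
  is_derive (fun t => surf a 1 s t) t
    (- dx w s t * surf a 0 s t + - (C0 * exp (- w s t)) * surf a 2 s t).
Proof.
  intros Ht. eapply is_derive_value.
  - exact (proj2 (surf_integral a 1%nat s t ltac:(lia) Ht)).
  - unfold mulmv; simpl; ring.
Qed.

Lemma surf_dt2 (a : nat) (s t : R) : D t ->
  is_derive (fun t => surf a 2 s t) t (C0 * exp (- w s t) * surf a 1 s t).
Proof.
  intros Ht. eapply is_derive_value.
  - exact (proj2 (surf_integral a 2%nat s t ltac:(lia) Ht)).
  - unfold mulmv; simpl; ring.
Qed.

Lemma surf_dt3 (a : nat) (s t : R) : D t ->
  is_derive (fun t => surf a 3 s t) t (exp (w s t) * surf a 1 s t).
Proof.
  intros Ht. eapply is_derive_value.
  - exact (proj2 (surf_integral a 3%nat s t ltac:(lia) Ht)).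
  - unfold mulmv; simpl; ring.
Qed.

Lemma surf_frame (s t : R) : D t ->
  orthonormal_frame (surfvec 0 s t) (surfvec 1 s t) (surfvec 2 s t).
Proof.
  intros Ht.
  assert (HI : orthonormal_frame (surfvec 0 0 0) (surfvec 1 0 0) (surfvec 2 0 0)).
  { unfold surfvec. rewrite !surf_init. simpl.
    repeat split; unfold dot, cross; simpl; try ring. apply vec3_ext; simpl; ring. }
  assert (HB : orthonormal_frame (surfvec 0 s 0) (surfvec 1 s 0) (surfvec 2 s 0)).
  { apply (orthonormal_frame_propagates (fun _ => True)
      (fun s => surfvec 0 s 0) (fun s => surfvec 1 s 0) (fun s => surfvec 2 s 0)
      (fun s => - dy w s 0) (fun s => C0 * exp (- w s 0)) (fun _ => 0) 0 s); auto.
    - intros x y z; auto.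
    - intros x _. unfold is_vderive; simpl.
      split; [| split]; exact (surf_ds0 _ x 0 HD0).
    - intros x _. unfold is_vderive; simpl.
      split; [| split]; (eapply is_derive_value; [exact (surf_ds1 _ x 0 HD0) | ring]).
    - intros x _. unfold is_vderive; simpl.
      split; [| split]; (eapply is_derive_value; [exact (surf_ds2 _ x 0 HD0) | ring]). }
  apply (orthonormal_frame_propagates D
      (fun t => surfvec 0 s t) (fun t => surfvec 1 s t) (fun t => surfvec 2 s t)
      (fun t => dx w s t) (fun _ => 0) (fun t => - (C0 * exp (- w s t))) 0 t); auto.
  - intros x Hx. unfold is_vderive; simpl.
    split; [| split]; (eapply is_derive_value; [exact (surf_dt0 _ s x Hx) | ring]).
  - intros x Hx. unfold is_vderive; simpl.
    split; [| split]; (eapply is_derive_value; [exact (surf_dt1 _ s x Hx) | ring]).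
  - intros x Hx. unfold is_vderive; simpl.
    split; [| split]; (eapply is_derive_value; [exact (surf_dt2 _ s x Hx) | ring]).
Qed.

Lemma surf_vdx (s t : R) : D t ->
  vdx (surfvec 3) s t = vscale (exp (w s t)) (surfvec 0 s t).
Proof.
  intros Ht. unfold vdx, vscale, surfvec; simpl.
  f_equal; apply is_derive_unique; exact (surf_ds3 _ s t Ht).
Qed.

Lemma surf_vdy (s t : R) : D t ->
  vdy (surfvec 3) s t = vscale (exp (w s t)) (surfvec 1 s t).
Proof.
  intros Ht. unfold vdy, vscale, surfvec; simpl.
  f_equal; apply is_derive_unique; exact (surf_dt3 _ s t Ht).
Qed.

Lemma surf_cross (s t : R) : D t ->
  cross (vdx (surfvec 3) s t) (vdy (surfvec 3) s t)
  = vscale (exp (w s t) * exp (w s t)) (surfvec 2 s t).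
Proof.
  intros Ht. rewrite surf_vdx, surf_vdy by auto.
  destruct (surf_frame s t Ht) as (_ & _ & _ & _ & _ & _ & <-).
  apply vec3_ext; unfold cross, vscale; simpl; ring.
Qed.

Lemma surf_conformal : conformal_factor U (surfvec 3) (fun s t => exp (w s t)).
Proof.
  intros s t Ht. rewrite surf_vdx, surf_vdy by auto.
  destruct (surf_frame s t Ht) as (Hu & Hv & _ & Huv & _).
  assert (Hd : forall k p q, dot (vscale k p) (vscale k q) = k * k * dot p q)
    by (intros; unfold dot, vscale; simpl; ring).
  rewrite !Hd, Hu, Hv, Huv. repeat split; try ring. apply exp_pos.
Qed.

(** With e1, e2, n the frame, (e^w e1)_s = e^w (w_s e1 - w_t e2) + C0 n and (e^w e2)_t = e^w (w_t e2
    - w_s e1) - C0 n. In conformal coordinates this is minimality. *)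
Lemma surf_harmonic (a : nat) (s t : R) : D t ->
  dx (dx (surf a 3)) s t + dy (dy (surf a 3)) s t = 0.
Proof.
  intros Ht.
  rewrite (dx_ext U open2_strip (dx (surf a 3)) (fun s t => exp (w s t) * surf a 0 s t));
    [| intros x y Hy; now apply is_derive_unique, surf_ds3 | exact Ht].
  rewrite (dy_ext U open2_strip (dy (surf a 3)) (fun s t => exp (w s t) * surf a 1 s t));
    [| intros x y Hy; now apply is_derive_unique, surf_dt3 | exact Ht].
  assert (H1 := surf_ds0 a s t Ht). assert (H2 := surf_dt1 a s t Ht).
  assert (E1 := is_derive_Rmult _ _ _ _ _ (is_derive_Rexp _ _ _ (w_ds s t Ht)) H1).
  assert (E2 := is_derive_Rmult _ _ _ _ _ (is_derive_Rexp _ _ _ (w_dt s t Ht)) H2).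
  apply is_derive_unique in E1, E2.
  etransitivity; [apply (f_equal2 Rplus); [exact E1 | exact E2] |]. ring.
Qed.

Lemma surf_minimal : minimal_immersion U (surfvec 3).
Proof.
  split; [split; [| split; [| split]] |].
  - apply (surf_smooth 0 3); lia.
  - apply (surf_smooth 1 3); lia.
  - apply (surf_smooth 2 3); lia.
  - intros s t Ht H. rewrite surf_cross in H by auto.
    destruct (surf_frame s t Ht) as (_ & _ & Hn & _).
    assert (E : dot (vscale (exp (w s t) * exp (w s t)) (surfvec 2 s t))
      (vscale (exp (w s t) * exp (w s t)) (surfvec 2 s t))
      = exp (w s t) * exp (w s t) * (exp (w s t) * exp (w s t))
        * dot (surfvec 2 s t) (surfvec 2 s t))
      by (unfold dot, vscale; simpl; ring).
    rewrite H, Hn in E. unfold dot in E; simpl in E.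
    assert (Hp := exp_pos (w s t)).
    assert (0 < exp (w s t) * exp (w s t)) by (apply Rmult_lt_0_compat; auto). nra.
  - intros s t Ht. unfold mean_curvature. cbv zeta.
    destruct (surf_conformal s t Ht) as (_ & HE & HG & HF).
    rewrite HE, HG, HF.
    set (n := unit_normal (surfvec 3) s t).
    (* In conformal coordinates the numerator of the mean curvature is [e + g] times the common
       value of [E] and [G], and [e + g] is the normal component of the Laplacian of the
       position. *)
    assert (Hs : dot n (vdx (vdx (surfvec 3)) s t) + dot n (vdy (vdy (surfvec 3)) s t) = 0).
    { replace (dot n (vdx (vdx (surfvec 3)) s t) + dot n (vdy (vdy (surfvec 3)) s t)) with
        (c1 n * (dx (dx (surf 0 3)) s t + dy (dy (surf 0 3)) s t)
         + c2 n * (dx (dx (surf 1 3)) s t + dy (dy (surf 1 3)) s t)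
         + c3 n * (dx (dx (surf 2 3)) s t + dy (dy (surf 2 3)) s t)).
      - rewrite !surf_harmonic by auto. ring.
      - unfold dot, vdx, vdy, surfvec; simpl.
        change (dx (fun a b => dx (fun a0 b0 => surf 0 3 a0 b0) a b) s t)
          with (dx (dx (surf 0 3)) s t).
        change (dx (fun a b => dx (fun a0 b0 => surf 1 3 a0 b0) a b) s t)
          with (dx (dx (surf 1 3)) s t).
        change (dx (fun a b => dx (fun a0 b0 => surf 2 3 a0 b0) a b) s t)
          with (dx (dx (surf 2 3)) s t).
        change (dy (fun a b => dy (fun a0 b0 => surf 0 3 a0 b0) a b) s t)
          with (dy (dy (surf 0 3)) s t).
        change (dy (fun a b => dy (fun a0 b0 => surf 1 3 a0 b0) a b) s t)
          with (dy (dy (surf 1 3)) s t).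
        change (dy (fun a b => dy (fun a0 b0 => surf 2 3 a0 b0) a b) s t)
          with (dy (dy (surf 2 3)) s t).
        ring. }
    set (e := dot n (vdx (vdx (surfvec 3)) s t)) in *.
    set (g := dot n (vdy (vdy (surfvec 3)) s t)) in *.
    replace g with (- e) by lra. unfold Rdiv.
    apply Rmult_eq_0_compat_r. ring.
Qed.

(* When w_t = - k e^w along Im xi = t0, the curve X + k X_t / |X_t| is stationary there. *)
Lemma surf_sphere (k t0 : R) : k * k = 1 -> D t0 ->
  (forall s, dy w s t0 = - k * exp (w s t0)) ->
  meets_unit_sphere_orthogonally_along (surfvec 3)
    (vadd (surfvec 3 0 t0) (vscale k (surfvec 1 0 t0))) t0.
Proof.
  intros Hk Ht Hbc s.
  assert (Hconst : forall a, surf a 3 s t0 + k * surf a 1 s t0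
    = surf a 3 0 t0 + k * surf a 1 0 t0).
  { intros a.
    apply (constant_of_derive_0 (fun _ => True) (fun s => surf a 3 s t0 + k * surf a 1 s t0));
      auto; [intros x y z; auto |].
    intros x _. assert (H1 := surf_ds1 a x t0 Ht). assert (H3 := surf_ds3 a x t0 Ht).
    eapply is_derive_value; [repeat derive_poly; eassumption |].
    rewrite Hbc. replace (0 * _ + _) with (- (k * k) * exp (w x t0) * surf a 0 x t0) by ring.
    rewrite Hk. ring. }
  assert (E : vsub (surfvec 3 s t0) (vadd (surfvec 3 0 t0) (vscale k (surfvec 1 0 t0)))
    = vscale (- k) (surfvec 1 s t0)).
  { apply vec3_ext; simpl; rewrite <- Hconst; ring. }
  destruct (surf_frame s t0 Ht) as (_ & H1 & _ & _ & _ & H2 & _).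
  rewrite E. split.
  - unfold vnorm. replace (dot _ _) with (k * k * dot (surfvec 1 s t0) (surfvec 1 s t0))
      by (unfold dot, vscale; simpl; ring).
    rewrite Hk, H1, Rmult_1_l. apply sqrt_1.
  - rewrite surf_cross by auto.
    replace (dot _ _) with (- k * (exp (w s t0) * exp (w s t0))
        * dot (surfvec 1 s t0) (surfvec 2 s t0)) by (unfold dot, vscale; simpl; ring).
    rewrite H2. ring.
Qed.

(** * Periodicity and the rigid motion *)

Variable (P : R).
Hypothesis (Hper : forall s t, w (s + P) t = w s t).

Lemma is_derive_shift (f : R -> R) (x l : R) :
  is_derive f (x + P) l -> is_derive (fun x => f (x + P)) x l.
Proof.
  intros H. eapply is_derive_value.
  - apply (is_derive_comp f (fun x => x + P) x l 1 H).
    eapply is_derive_value.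
    + apply (is_derive_Rplus (fun x => x) (fun _ => P)).
      * apply (is_derive_id (K := R_AbsRing)).
      * apply is_derive_Rconst.
    + unfold one; simpl; ring.
  - unfold scal; simpl. unfold mult; simpl. ring.
Qed.

Lemma dx_periodic (s t : R) : D t -> dx w (s + P) t = dx w s t.
Proof.
  intros Ht. symmetry. apply is_derive_unique.
  apply (is_derive_ext (fun s => w (s + P) t)); [intros; apply Hper |].
  apply (is_derive_shift (fun s => w s t)). now apply w_ds.
Qed.

Lemma dy_periodic (s t : R) : dy w (s + P) t = dy w s t.
Proof. apply Derive_ext. intros; apply Hper. Qed.

(** Over the origin the frame is the standard basis and the position is 0, so the motion carrying
    these data to those over [(P, 0)] has the frame there as its columns and the position there as
    its translation. *)
Definition period_motion : vec3 -> vec3 :=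
  frame_motion (surfvec 0 P 0) (surfvec 1 P 0) (surfvec 2 P 0) (surfvec 3 P 0).

Definition period_motion_inv : vec3 -> vec3 :=
  frame_motion_inv (surfvec 0 P 0) (surfvec 1 P 0) (surfvec 2 P 0) (surfvec 3 P 0).

(* Both sides solve the frame system with the same initial value at the origin. *)
Lemma period_motion_surf (s t : R) : D t ->
  period_motion (surfvec 3 s t) = surfvec 3 (s + P) t.
Proof.
  intros Ht.
  (* Linear combinations of solutions are solutions. The translation is added in row 3 only, and
     this is harmless because column 3 of both coefficient matrices is zero. *)
  assert (H : forall a i s t, (i <= 3)%nat -> D t ->
    surf 0 i s t * surf a 0 P 0 + surf 1 i s t * surf a 1 P 0
      + surf 2 i s t * surf a 2 P 0 + (if Nat.eqb i 3 then surf a 3 P 0 else 0)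
    = surf a i (s + P) t).
  { clear s t Ht. intros a.
    apply (integral_surface_unique 3 coefA coefB D 0) with
      (y := fun i s t => surf 0 i s t * surf a 0 P 0 + surf 1 i s t * surf a 1 P 0
      + surf 2 i s t * surf a 2 P 0 + (if Nat.eqb i 3 then surf a 3 P 0 else 0))
      (z := fun i s t => surf a i (s + P) t); auto.
    - intros; apply smooth_coefA.
    - intros; apply smooth_coefB.
    - intros i s t Hi Ht.
      destruct (surf_integral 0 i s t Hi Ht) as [A0 B0].
      destruct (surf_integral 1 i s t Hi Ht) as [A1 B1].
      destruct (surf_integral 2 i s t Hi Ht) as [A2 B2].
      split; (eapply is_derive_value; [repeat derive_poly; eassumption |]);
        unfold mulmv; destruct i as [|[|[|[|i]]]]; try lia; simpl; ring.
    - intros i s t Hi Ht. destruct (surf_integral a i (s + P) t Hi Ht) as [A1 B1]. split.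
      + eapply is_derive_value; [apply (is_derive_shift (fun s => surf a i s t)), A1 |].
        apply sum_eq. intros j Hj. f_equal.
        unfold coefA. rewrite Hper, dy_periodic. reflexivity.
      + eapply is_derive_value; [exact B1 |].
        apply sum_eq. intros j Hj. f_equal.
        unfold coefB. rewrite Hper, dx_periodic by auto. reflexivity.
    - intros i Hi. rewrite !surf_init, Rplus_0_l.
      destruct i as [|[|[|[|i]]]]; try lia; simpl; ring. }
  assert (E := fun a => H a 3%nat s t (Nat.le_refl 3) Ht). simpl in E.
  apply vec3_ext; simpl; apply E.
Qed.

Lemma period_motion_rigid : rigid_motion period_motion.
Proof. apply frame_motion_rigid. now apply surf_frame. Qed.

Lemma period_motionK (p : vec3) :
  period_motion (period_motion_inv p) = p /\ period_motion_inv (period_motion p) = p.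
Proof.
  split; [apply frame_motionK | apply frame_motion_invK]; now apply surf_frame.
Qed.

Lemma period_motion_Zpow (n : Z) (s t : R) : D t ->
  Zpow_map period_motion period_motion_inv n (surfvec 3 s t)
  = surfvec 3 (s + IZR n * P) t.
Proof.
  intros Ht.
  assert (Hp : forall m, Nat.iter m period_motion (surfvec 3 s t)
    = surfvec 3 (s + INR m * P) t).
  { induction m as [|m IH].
    - simpl. f_equal. ring.
    - change (period_motion (Nat.iter m period_motion (surfvec 3 s t))
        = surfvec 3 (s + INR (S m) * P) t).
      rewrite IH, period_motion_surf by auto. f_equal. rewrite S_INR. ring. }
  assert (Hm : forall m, Nat.iter m period_motion_inv (surfvec 3 s t)
    = surfvec 3 (s - INR m * P) t).
  { induction m as [|m IH].
    - simpl. f_equal. ring.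
    - change (period_motion_inv (Nat.iter m period_motion_inv (surfvec 3 s t))
        = surfvec 3 (s - INR (S m) * P) t).
      rewrite IH. replace (s - INR m * P) with (s - INR (S m) * P + P)
        by (rewrite S_INR; ring).
      rewrite <- period_motion_surf by auto. apply period_motionK. }
  destruct n as [|p|p]; simpl Zpow_map.
  - f_equal. ring.
  - rewrite Hp. f_equal. now rewrite INR_IZR_INZ, positive_nat_Z.
  - rewrite Hm. f_equal. rewrite INR_IZR_INZ, positive_nat_Z.
    change (Zneg p) with (- Zpos p)%Z. rewrite opp_IZR. ring.
Qed.

End Surface.

(** * The annulus in the logarithmic coordinate *)

(** The pullback of [f] under the covering map z = e^{-i xi}, with xi = s + i t. *)
Definition polar (f : R -> R -> R) (s t : R) : R :=
  f (exp t * cos s) (- (exp t * sin s)).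

Lemma polar_radius (s t : R) :
  sqrt ((exp t * cos s) ^ 2 + (- (exp t * sin s)) ^ 2) = exp t.
Proof.
  pose proof (exp_pos t). pose proof (sin2_cos2 s) as H1. unfold Rsqr in H1.
  replace ((exp t * cos s) ^ 2 + (- (exp t * sin s)) ^ 2) with (exp t ^ 2).
  - apply sqrt_pow2. lra.
  - transitivity (exp t ^ 2 * (sin s * sin s + cos s * cos s)); [rewrite H1 |]; ring.
Qed.

Lemma open2_annulus (a b : R) : open2 (annulus a b).
Proof.
  assert (Hc : forall p : R * R, continuous (fun p : R * R =>
    sqrt (fst p ^ 2 + snd p ^ 2)) p).
  { intros p. apply (continuous_comp (fun p : R * R => fst p ^ 2 + snd p ^ 2) sqrt).
    - apply (continuous_plus (V := R_NormedModule)
        (fun p : R * R => fst p ^ 2) (fun p : R * R => snd p ^ 2)).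
      + apply (continuous_comp (fun p : R * R => fst p) (fun x => x ^ 2));
          [apply continuous_fst |].
        apply (ex_derive_continuous (fun x => x ^ 2)). auto_derive; exact I.
      + apply (continuous_comp (fun p : R * R => snd p) (fun x => x ^ 2));
          [apply continuous_snd |].
        apply (ex_derive_continuous (fun x => x ^ 2)). auto_derive; exact I.
    - apply continuous_sqrt. }
  unfold open2, annulus. apply open_and.
  - apply (open_comp (fun p : R * R => sqrt (fst p ^ 2 + snd p ^ 2)) (fun r => a < r)).
    + intros p _. apply Hc.
    + apply open_gt.
  - apply (open_comp (fun p : R * R => sqrt (fst p ^ 2 + snd p ^ 2)) (fun r => r < b)).
    + intros p _. apply Hc.
    + apply open_lt.
Qed.

Lemma polar_ds (V : R -> R -> Prop) (f : R -> R -> R) (s t : R) :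
  open2 V -> Ck 1 V f -> V (exp t * cos s) (- (exp t * sin s)) ->
  is_derive (fun s => polar f s t) s
    (- polar (dx f) s t * (exp t * sin s) - polar (dy f) s t * (exp t * cos s)).
Proof.
  intros HV Hf Hst. eapply is_derive_value.
  - apply (chain_rule_2 V f (fun s => exp t * cos s) (fun s => - (exp t * sin s)) s
      (- (exp t * sin s)) (- (exp t * cos s))); auto;
      auto_derive; auto; ring.
  - unfold polar. ring.
Qed.

Lemma polar_dt (V : R -> R -> Prop) (f : R -> R -> R) (s t : R) :
  open2 V -> Ck 1 V f -> V (exp t * cos s) (- (exp t * sin s)) ->
  is_derive (fun t => polar f s t) t
    (polar (dx f) s t * (exp t * cos s) - polar (dy f) s t * (exp t * sin s)).
Proof.
  intros HV Hf Hst. eapply is_derive_value.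
  - apply (chain_rule_2 V f (fun t => exp t * cos s) (fun t => - (exp t * sin s)) t
      (exp t * cos s) (- (exp t * sin s))); auto;
      auto_derive; auto; ring.
  - unfold polar. ring.
Qed.

(* [polar_scale v] is log Lambda, read off from part (1) of the theorem. *)
Definition polar_scale (v : R -> R -> R) (s t : R) : R := - (1 / 2) * polar v s t + - t.

Section LogCoordinate.

Variables (v : R -> R -> R) (a b : R) (D : R -> Prop).
Let V : R -> R -> Prop := annulus a b.
Let U (_ t : R) : Prop := D t.
Hypotheses (HDo : open D) (HDV : forall t, D t -> a < exp t < b) (Hv : smooth_on V v).

Lemma polar_annulus (s t : R) : D t -> V (exp t * cos s) (- (exp t * sin s)).
Proof. intros Ht. unfold V, annulus. rewrite polar_radius. auto. Qed.

Lemma smooth_polar_scale : smooth_on U (polar_scale v).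
Proof.
  pose proof (open2_strip D HDo : open2 U) as HU.
  intros k. unfold polar_scale.
  apply Ck_plus; auto; [apply Ck_scal; auto | apply Ck_opp; auto; apply Ck_snd; auto].
  apply (Ck_comp U V (fun s t => exp t * cos s) (fun s t => - (exp t * sin s))); auto.
  - apply open2_annulus.
  - intros s t Ht. now apply polar_annulus.
  - intros m. apply Ck_mult; auto; [apply Ck_exp; auto; apply Ck_snd; auto |].
    apply Ck_cos_sin; auto.
  - intros m. apply Ck_opp; auto. apply Ck_mult; auto; [apply Ck_exp; auto; apply Ck_snd; auto |].
    apply Ck_cos_sin; auto.
Qed.

Lemma dx_polar_scale (s t : R) : D t -> dx (polar_scale v) s t =
  1 / 2 * (polar (dx v) s t * (exp t * sin s) + polar (dy v) s t * (exp t * cos s)).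
Proof.
  intros Ht. apply is_derive_unique. unfold polar_scale. eapply is_derive_value.
  - repeat derive_poly.
    apply (polar_ds V); [apply open2_annulus | apply Hv | now apply polar_annulus].
  - lra.
Qed.

Lemma dy_polar_scale (s t : R) : D t -> dy (polar_scale v) s t =
  - (1 / 2) * (polar (dx v) s t * (exp t * cos s) - polar (dy v) s t * (exp t * sin s)) - 1.
Proof.
  intros Ht. apply is_derive_unique. unfold polar_scale. eapply is_derive_value.
  - repeat derive_poly.
    + apply (polar_dt V); [apply open2_annulus | apply Hv | now apply polar_annulus].
    + apply (is_derive_id (K := R_AbsRing)).
  - unfold one; simpl. lra.
Qed.

(** The covering map is holomorphic with |dz/dxi| = e^t, so the Laplacian is multiplied by e^{2t},
    and the term -t is harmonic. In the computation the mixed derivatives of [v] cancel between the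
    two summands. *)
Lemma laplacian_polar_scale (s t : R) : D t ->
  dx (dx (polar_scale v)) s t + dy (dy (polar_scale v)) s t
  = - (1 / 2) * (exp t ^ 2 * polar (laplacian v) s t).
Proof.
  intros Ht. pose proof (open2_strip D HDo : open2 U) as HU.
  pose proof (open2_annulus a b : open2 V) as HV.
  pose proof (polar_annulus s t Ht) as Hst.
  assert (Hvx : Ck 1 V (dx v)) by (apply Ck_S_dx, Hv).
  assert (Hvy : Ck 1 V (dy v)) by (apply Ck_S_dy, Hv).
  rewrite (dx_ext U HU _ _ dx_polar_scale s t Ht), (dy_ext U HU _ _ dy_polar_scale s t Ht).
  assert (Es : is_derive (fun s => sin s) s (cos s)) by apply is_derive_sin.
  assert (Ec : is_derive (fun s => cos s) s (- sin s)) by apply is_derive_cos.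
  assert (Et : is_derive (fun t => exp t) t (exp t)) by apply is_derive_exp.
  pose proof (polar_ds V (dx v) s t HV Hvx Hst) as A1.
  pose proof (polar_ds V (dy v) s t HV Hvy Hst) as A2.
  pose proof (polar_dt V (dx v) s t HV Hvx Hst) as B1.
  pose proof (polar_dt V (dy v) s t HV Hvy Hst) as B2.
  etransitivity.
  - apply (f_equal2 Rplus).
    + apply is_derive_unique.
      repeat first [eassumption | derive_poly].
    + apply is_derive_unique. unfold Rminus.
      repeat first [eassumption | derive_poly].
  - change (polar (laplacian v) s t)
      with (polar (dx (dx v)) s t + polar (dy (dy v)) s t).
    assert (E : sin s * sin s = 1 - cos s * cos s).
    { pose proof (sin2_cos2 s) as H. unfold Rsqr in H. lra. }
    set (p := polar (dx (dx v)) s t). set (q := polar (dy (dy v)) s t).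
    set (c := cos s) in *. set (d := sin s) in *. set (e := exp t).
    transitivity (- (1 / 2) * (e * e * (p + q)) * (d * d + c * c)); [field |].
    rewrite E. ring.
Qed.

End LogCoordinate.

(* v is a function of z = x + i y, written v x y.
   e^{-i xi} with xi = s + i t is the point (e^t cos s, - e^t sin s). *)
Theorem theorem5p1 (Rr eps C0 : R) (v : R -> R -> R)
  (HR : 1 < Rr) (Heps0 : 0 < eps) (Heps1 : eps < 1)
  (Hsmooth : smooth_on (annulus (1 - eps) (Rr + eps)) v)
  (Hpde : forall x y, annulus (1 - eps) (Rr + eps) x y ->
            laplacian v x y + 2 * C0 ^ 2 * exp (v x y) = 0)
  (Hbc1 : forall x y, sqrt (x ^ 2 + y ^ 2) = 1 ->
            (* inner normal to A(1,R) at |z| = 1 is z/|z| *)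
            x * dx v x y + y * dy v x y = 2 * exp (- (1 / 2) * v x y) - 2)
  (HbcR : forall x y, sqrt (x ^ 2 + y ^ 2) = Rr ->
            (* inner normal to A(1,R) at |z| = R is -z/R *)
            - (x * dx v x y + y * dy v x y) / Rr
              = 2 / Rr ^ 2 * exp (- (1 / 2) * v x y) + 2 / Rr) :
  exists (X : R -> R -> vec3) (Lam : R -> R -> R) (O1 O2 : vec3)
         (T Tinv : vec3 -> vec3),
    minimal_immersion (strip_H Rr eps) X /\
    (* (1) *)
    conformal_factor (strip_H Rr eps) X Lam /\
    (forall s t, strip_H Rr eps s t ->
       v (exp t * cos s) (- (exp t * sin s))
       = ln (1 / (Lam s t ^ 2 * exp t ^ 2))) /\
    (* (2) *)
    meets_unit_sphere_orthogonally_along X O1 0 /\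
    meets_unit_sphere_orthogonally_along X O2 (ln Rr) /\
    (* (3) *)
    rigid_motion T /\
    (forall p, T (Tinv p) = p /\ Tinv (T p) = p) /\
    (forall p, (exists s t, strip_H0 Rr eps s t /\ p = T (X s t)) <->
               (exists s t, strip_H0 Rr eps s t /\ p = X (s + 2 * PI) t)) /\
    (forall p, (exists s t, strip_H Rr eps s t /\ p = X s t) <->
               (exists (n : Z) s t, strip_H0 Rr eps s t /\
                                    p = Zpow_map T Tinv n (X s t))).
Proof.
  set (D := fun t => ln (1 - eps) < t < ln (Rr + eps)).
  set (w := polar_scale v).
  assert (HDo : open D) by (apply open_and; [apply open_gt | apply open_lt]).
  assert (HDc : convex D) by (intros x y z Hx Hy Hz; unfold D in *; lra).
  assert (HDV : forall t, D t -> 1 - eps < exp t < Rr + eps).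
  { intros t [H1 H2]. apply exp_increasing in H1, H2.
    rewrite exp_ln in H1, H2 by lra. lra. }
  assert (HD0 : D 0).
  { unfold D. rewrite <- ln_1. split; apply ln_increasing; lra. }
  assert (HDR : D (ln Rr)) by (split; apply ln_increasing; lra).
  assert (Hw : smooth_on (fun _ t => D t) w)
    by (apply (smooth_polar_scale v (1 - eps) (Rr + eps)); auto).
  assert (HL : forall s t, D t ->
    dx (dx w) s t + dy (dy w) s t = C0 ^ 2 * exp (- (2 * w s t))).
  { intros s t Ht.
    unfold w. rewrite (laplacian_polar_scale v (1 - eps) (Rr + eps) D) by auto.
    pose proof (Hpde _ _ (polar_annulus (1 - eps) (Rr + eps) D HDV s t Ht)) as H.
    (* The conformal weight e^{2t} of the Laplacian is exactly what turns e^v into e^{-2w}. *)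
    replace (exp (- (2 * polar_scale v s t))) with (exp t ^ 2 * exp (polar v s t)).
    - unfold polar at 1. unfold polar in *.
      replace (laplacian v (exp t * cos s) (- (exp t * sin s))) with
        (- (2 * C0 ^ 2 * exp (v (exp t * cos s) (- (exp t * sin s))))) by lra.
      field.
    - replace (exp t ^ 2) with (exp (t + t)) by (rewrite exp_plus; ring).
      rewrite <- exp_plus. f_equal. unfold polar_scale. field. }
  assert (Hper : forall s t, w (s + 2 * PI) t = w s t).
  { intros s t. unfold w, polar_scale, polar.
    rewrite cos_plus, sin_plus, cos_2PI, sin_2PI, !Rmult_0_r, !Rmult_1_r, Rminus_0_r, Rplus_0_r.
    reflexivity. }
  (* The constant -2 of the boundary condition, multiplied by -1/2, cancels the -1 coming from the
     term -t of [w]. The form [- (1)] is that of [surf_sphere] with [k = 1]. *)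
  assert (Hw1 : forall s, dy w s 0 = - (1) * exp (w s 0)).
  { intros s. unfold w. rewrite (dy_polar_scale v (1 - eps) (Rr + eps) D) by auto.
    pose proof (Hbc1 (exp 0 * cos s) (- (exp 0 * sin s))) as H.
    rewrite polar_radius in H. specialize (H exp_0).
    unfold polar_scale. rewrite Ropp_0, Rplus_0_r. unfold polar in *. lra. }
  (* Here [k = -1]. The inner normal points towards the origin, and the factor 1/R in e^w =
     e^{-v/2}/R accounts for the power of R in the boundary condition. *)
  assert (HwR : forall s, dy w s (ln Rr) = - (-1) * exp (w s (ln Rr))).
  { intros s. unfold w. rewrite (dy_polar_scale v (1 - eps) (Rr + eps) D) by auto.
    pose proof (HbcR (exp (ln Rr) * cos s) (- (exp (ln Rr) * sin s))) as H.
    rewrite polar_radius, exp_ln in H by lra. specialize (H eq_refl).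
    unfold polar_scale. rewrite exp_plus, exp_Ropp, exp_ln by lra.
    unfold polar in *. rewrite exp_ln by lra.
    set (E := exp (- (1 / 2) * v (Rr * cos s) (- (Rr * sin s)))) in *.
    set (x := Rr * cos s * dx v _ _ + _) in H.
    assert (Hx : x = - (2 * (E / Rr)) - 2).
    { replace x with (- Rr * (- x / Rr)) by (field; lra). rewrite H. field. lra. }
    unfold x in Hx. unfold Rdiv in Hx. lra. }
  exists (surfvec w C0 3), (fun s t => exp (w s t)),
    (vadd (surfvec w C0 3 0 0) (vscale 1 (surfvec w C0 1 0 0))),
    (vadd (surfvec w C0 3 0 (ln Rr)) (vscale (-1) (surfvec w C0 1 0 (ln Rr)))),
    (period_motion w C0 (2 * PI)), (period_motion_inv w C0 (2 * PI)).
  split; [| split; [| split; [| split; [| split; [| split; [| split; [| split]]]]]]].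
  - now apply (surf_minimal w C0 D).
  - now apply (surf_conformal w C0 D).
  - intros s t Ht. unfold w, polar_scale.
    replace (1 / (_ ^ 2 * _)) with (exp (v (exp t * cos s) (- (exp t * sin s)))).
    + now rewrite ln_exp.
    + fold (polar v s t).
      replace (exp (- (1 / 2) * polar v s t + - t) ^ 2 * exp t ^ 2)
        with (exp (- polar v s t)).
      * rewrite exp_Ropp. field. apply Rgt_not_eq, exp_pos.
      * rewrite <- Rpow_mult_distr, <- exp_plus. simpl. rewrite Rmult_1_r, <- exp_plus.
        f_equal. field.
  - apply (surf_sphere w C0 D); auto. ring.
  - apply (surf_sphere w C0 D); auto. ring.
  - now apply (period_motion_rigid w C0 D).
  - intros p. now apply (period_motionK w C0 D).
  - intros p. split; intros (s & t & Hst & ->); exists s, t; (split; [exact Hst |]).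
    + apply (period_motion_surf w C0 D); auto. apply Hst.
    + symmetry. apply (period_motion_surf w C0 D); auto. apply Hst.
  - intros p. split.
    + intros (s & t & Ht & ->).
      pose proof PI_RGT_0 as Hpi.
      (* The integer part moves [s] into the fundamental interval from 0 to 2 pi. *)
      set (n := Int_part (s / (2 * PI))).
      exists n, (s - IZR n * (2 * PI)), t. split.
      * split; [exact Ht |].
        destruct (base_Int_part (s / (2 * PI))) as [H1 H2]. fold n in H1, H2.
        assert (E : s = s / (2 * PI) * (2 * PI)) by (field; lra).
        set (r := s / (2 * PI)) in *. rewrite E. nra.
      * rewrite (period_motion_Zpow w C0 D) by auto. f_equal. ring.
    + intros (n & s & t & Hst & ->). exists (s + IZR n * (2 * PI)), t.
      split; [apply Hst |]. apply (period_motion_Zpow w C0 D); auto. apply Hst.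
Qed.
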